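(* Let $0<R_1<R_0<R_2$, and let $\Gamma_{R_0}$ be a closed subset of $\mathbb{S}_{R_0}$ with $\Gamma_{R_0}\neq\mathbb{S}_{R_0}$. Then, for every $\varepsilon>0$ and every function $g\in L^2(\mathbb{S}_{R_2})$, there exists $f\in L^2(\mathbb{S}_{R_2})$ (depending on $\varepsilon$ and $g$) such that $$\left|\langle\Phi^{R_1,R_0,R_2}[\mathbf{m},h],f\rangle_{L^2(\mathbb{S}_{R_2})}-\langle\Phi_0^{R_0,R_2}[\mathbf{m}],g\rangle_{L^2(\mathbb{S}_{R_2})}\right|\le\varepsilon\,\|(\mathbf{m},h)\|_{L^2(\Gamma_{R_0},\mathbb{R}^3)\times L^2(\mathbb{S}_{R_1})}$$ for all $\mathbf{m}\in L^2(\Gamma_{R_0},\mathbb{R}^3)$ and $h\in L^2(\mathbb{S}_{R_1})$.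
   Context: $\mathbb{S}_R=\{x\in\mathbb{R}^3:|x|=R\}$, with surface measure $\omega_R$. For $\mathbf{m}\in L^2(\Gamma_{R_0},\mathbb{R}^3)$ and $h\in L^2(\mathbb{S}_{R_1})$, define for $x\in\mathbb{S}_{R_2}$ $$\Phi_0^{R_0,R_2}[\mathbf{m}](x)=\frac{1}{4\pi}\int_{\Gamma_{R_0}}\mathbf{m}(y)\cdot\frac{x-y}{|x-y|^3}\,d\omega_{R_0}(y),\qquad \Phi_1^{R_1,R_2}[h](x)=\frac{1}{4\pi R_1}\int_{\mathbb{S}_{R_1}}h(y)\frac{|x|^2-R_1^2}{|x-y|^3}\,d\omega_{R_1}(y),$$ and $\Phi^{R_1,R_0,R_2}[\mathbf{m},h]=\Phi_0^{R_0,R_2}[\mathbf{m}]+\Phi_1^{R_1,R_2}[h]\in L^2(\mathbb{S}_{R_2})$. The product space carries the Hilbert norm $\|(\mathbf{m},h)\|^2=\|\mathbf{m}\|^2_{L^2(\Gamma_{R_0},\mathbb{R}^3)}+\|h\|^2_{L^2(\mathbb{S}_{R_1})}$. *)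

(* Defs.v *)
From HB Require Import structures.
From mathcomp Require Import all_boot all_order all_algebra.
From mathcomp Require Import all_classical all_reals all_analysis.
From mathcomp Require Import measurable_realfun.

Set Implicit Arguments.
Unset Strict Implicit.
Unset Printing Implicit Defensive.

Import Order.TTheory GRing.Theory Num.Theory.
Import numFieldNormedType.Exports.

Local Open Scope classical_set_scope.
Local Open Scope ring_scope.

(* Points and vectors of R^3 are triples [(x1, x2, x3)].  The topology and the
   Borel sigma-algebra are those of the product; the library norm on products is
   the sup norm, hence the explicit Euclidean norm [enorm] below. *)
Notation point3 R := (R * R * R)%type.

Section Euclidean.
Context {R : realType}.
Implicit Types x y : point3 R.

Definition edot x y : R := x.1.1 * y.1.1 + x.1.2 * y.1.2 + x.2 * y.2.

Definition enorm x : R := Num.sqrt (edot x x).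

Definition sphere (r : R) : set (point3 R) := [set x | enorm x = r].

End Euclidean.

Section SurfaceMeasure.
Context {R : realType}.
Local Notation leb := (@lebesgue_measure R).

(* Spherical coordinates, [p = (theta, phi)] with [theta] the polar angle. *)
Definition spherical (r : R) (p : R * R) : point3 R :=
  (r * (sin p.1 * cos p.2), r * (sin p.1 * sin p.2), r * cos p.1).

Definition angles : set (R * R) := `[0, pi] `*` `[0, 2 * pi].

(* The surface measure of the sphere of radius [r], as a measure on the whole
   space: the area element is [r^2 sin theta dtheta dphi]. *)
Definition surface (r : R) (A : set (point3 R)) : \bar R :=
  (\int[(leb \x leb)%E]_(p in angles `&` spherical r @^-1` A)
     (r ^+ 2 * sin p.1)%:E)%E.

Let measurable_spherical r : measurable_fun [set: R * R] (spherical r).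
Proof.
have msin : measurable_fun [set: R] (@sin R).
  by apply: continuous_measurable_fun; exact: continuous_sin.
have mcos : measurable_fun [set: R] (@cos R).
  by apply: continuous_measurable_fun; exact: continuous_cos.
apply: measurable_fun_pair; [apply: measurable_fun_pair|];
  apply: measurable_funM => //; try apply: measurable_funM;
  by [exact: measurableT_comp msin _ | exact: measurableT_comp mcos _].
Qed.

Let measurable_angles : measurable angles.
Proof. by apply: measurableX; exact: measurable_itv. Qed.

Let density_ge0 r (p : R * R) : angles p -> (0 <= (r ^+ 2 * sin p.1)%:E)%E.
Proof.
case=> /= + _; rewrite in_itv /= => p1; rewrite lee_fin.
by rewrite mulr_ge0 ?sqr_ge0 ?sin_ge0_pi.
Qed.

Let surface0 r : surface r set0 = 0%E.
Proof. by rewrite /surface preimage_set0 setI0 integral_set0. Qed.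

Let surface_ge0 r A : (0 <= surface r A)%E.
Proof. by apply: integral_ge0 => p [? _]; exact: density_ge0. Qed.

Let surface_sigma_additive r : semi_sigma_additive (surface r).
Proof.
move=> /= A mA tA mUA.
rewrite /surface preimage_bigcup setI_bigcupr ge0_integral_bigcup//=.
- apply: is_cvg_ereal_nneg_natsum_cond => n _ _.
  by apply: integral_ge0 => p [? _]; exact: density_ge0.
- move=> k; apply: measurableI => //.
  by rewrite -[_ @^-1` _]setTI; exact: measurable_spherical.
- apply: measurable_funTS; apply/measurable_EFinP.
  apply: measurable_funM => //; apply: measurableT_comp => //.
  by apply: continuous_measurable_fun; exact: continuous_sin.
- by move=> p [k _ [? _]]; exact: density_ge0.
- apply/trivIsetP => i j _ _ ij; rewrite setIACA setIid -preimage_setI.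
  by move/trivIsetP : tA => ->//; rewrite preimage_set0 setI0.
Qed.

HB.instance Definition _ (r : R) := isMeasure.Build _ _ _ (surface r)
  (surface0 r) (surface_ge0 r) (@surface_sigma_additive r).

End SurfaceMeasure.

Section L2.
Context {R : realType}.
Implicit Types (r : R) (S : set (point3 R)).

(* [S] is a measurable subset of the sphere of radius [r].  Elements of L^2(S)
   are given by representatives; their values outside [S] are irrelevant, which
   is why [f \_ S] (equal to [f] on [S] and to [0] elsewhere) is used. *)
Definition L2 r S (f : point3 R -> R) : Prop :=
  (f \_ S) \in Lfun (surface r) 2%:E.

Definition L2norm r S (f : point3 R -> R) : R :=
  fine ('N[surface r]_2%:E [EFin \o (f \_ S)])%E.

Definition L2inner r S (f g : point3 R -> R) : R :=
  \int[surface r]_(x in S) (f x * g x).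

Definition L2vec r S (m : point3 R -> point3 R) : Prop :=
  [/\ L2 r S (fun y => (m y).1.1), L2 r S (fun y => (m y).1.2)
    & L2 r S (fun y => (m y).2)].

Definition L2vec_norm r S (m : point3 R -> point3 R) : R :=
  L2norm r S (enorm \o m).

Definition prod_norm r0 S0 r1 S1 (m : point3 R -> point3 R)
    (h : point3 R -> R) : R :=
  Num.sqrt (L2vec_norm r0 S0 m ^+ 2 + L2norm r1 S1 h ^+ 2).

End L2.

Section Potentials.
Context {R : realType}.
Implicit Types (Gamma : set (point3 R)).

Definition Phi0 (R0 : R) Gamma (m : point3 R -> point3 R) (x : point3 R) : R :=
  (4 * pi)^-1 * \int[surface R0]_(y in Gamma)
    (edot (m y) (x - y) / enorm (x - y) ^+ 3).

Definition Phi1 (R1 : R) (h : point3 R -> R) (x : point3 R) : R :=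
  (4 * pi * R1)^-1 * \int[surface R1]_(y in sphere R1)
    (h y * ((enorm x ^+ 2 - R1 ^+ 2) / enorm (x - y) ^+ 3)).

Definition Phi (R1 R0 : R) Gamma (m : point3 R -> point3 R) (h : point3 R -> R)
    (x : point3 R) : R :=
  Phi0 R0 Gamma m x + Phi1 R1 h x.

End Potentials.

(* Main.v *)
(* By duality it suffices to approximate the adjoint data: writing
   u_f(y) = (1/4pi) \int f(x) / |x - y| dw(x) for a density f on the sphere of
   radius R2, one needs f with grad u_f close to grad u_g on Gamma and
   (2 r d/dr + 1) u_f close to 0 on the sphere of radius R1.  Let V be the space
   of such pairs of data (f bounded) and p the uniform distance to V.  For each
   of the kernels W0(x), W1(x) (data on Gamma, resp. on the inner sphere, of a
   pole at x), p is a continuous function of x satisfying a mean value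
   inequality up to O(t^4), hence a maximum principle.
   - p(W0 + W1) = 0 for |x| = R2 by averaging over small caps, hence for
     |x| >= R2 since the kernels vanish at infinity;
   - the kernels have uniformly convergent Taylor expansions along lines, so the
     vanishing propagates inwards through the hole of Gamma, to the whole shell
     R1 < |x| < R0;
   - on that shell p(W0) = p(W1), so p(W0) inside and p(W1) outside glue to a
     function on the whole space that satisfies the maximum principle and
     vanishes at infinity, hence is 0 (Liouville).
   Thus p(W0(x)) = 0 for |x| = R2, and integrating against g gives the claim. *)
From HB Require Import structures.
Require Import Defs.
From mathcomp Require Import all_boot all_order all_algebra.
From mathcomp Require Import all_classical all_reals all_analysis.
From mathcomp Require Import measurable_realfun ring lra.
Import Order.TTheory GRing.Theory Num.Theory.
Import numFieldNormedType.Exports.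
Local Open Scope classical_set_scope.
Local Open Scope ring_scope.

Set Implicit Arguments.
Unset Strict Implicit.
Unset Printing Implicit Defensive.

(** * Power series of the Newtonian kernel along a line *)

(** The classical density argument takes a functional that annihilates [V] and studies the harmonic
    function it makes of the kernels. Here the seminorm [dist] stands for all such functionals at
    once: subadditivity turns the harmonicity of x -> W(x) into a mean value inequality, and
    vanishing of [dist] is a linear condition stable under uniform limits, so it passes to Taylor
    coefficients and back. Every estimate must therefore be uniform over all poles; this is why the
    kernels are expanded along lines, with explicit coefficients and remainders. Gluing works
    because W0 is singular only on Gamma and W1 only on the inner sphere: each side uses the kernel
    that is regular there. Data are compared in the uniform norm because the sources enter through
    L^1 norms, which L^2 norms control on surfaces of finite area. *)

Section Gegenbauer.
Context {R : realType}.
Variables (b d : R).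

(* The pair of consecutive Taylor coefficients of order n and n.+1 of
   (1 + 2 b t + d t^2)^(-3/2): Gegenbauer's recurrence. *)
Fixpoint gcoef2 (n : nat) : R * R :=
  if n is m.+1 then
    let c := gcoef2 m in
    (c.2, - (b * (2 * m.+1%:R + 3) * c.2 + d * (m.+1%:R + 2) * c.1) / m.+2%:R)
  else (1, - (3 * b)).

Definition gcoef n := (gcoef2 n).1.

Lemma gcoef0 : gcoef 0 = 1. Proof. by []. Qed.

Lemma gcoef1 : gcoef 1 = - (3 * b). Proof. by []. Qed.

Lemma gcoef_rec m : m.+2%:R * gcoef m.+2 =
  - (b * (2 * m.+1%:R + 3) * gcoef m.+1 + d * (m.+1%:R + 2) * gcoef m).
Proof. by rewrite /gcoef /= mulrC divfK// pnatr_eq0. Qed.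

Lemma gcoef_2 : gcoef 2 = (15 * b ^+ 2 - 3 * d) / 2.
Proof.
have := gcoef_rec 0; rewrite gcoef1 gcoef0 => h.
by apply: (@mulfI _ 2%:R) => //; rewrite h; field.
Qed.

(** The recurrence has order two, so two consecutive bounds are carried. With [X = (4 B)^n] its
    right-hand side is at most [(9 n + 23) B^2 X], while the ratio 4 leaves room up to
    [16 (n + 2) B^2 X]. *)
Lemma gcoef_bound (B : R) : 0 <= B -> `|b| <= B -> `|d| <= B ^+ 2 ->
  forall n, `|gcoef n| <= (4 * B) ^+ n.
Proof.
move=> B0 bB dB n.
suff: `|gcoef n| <= (4 * B) ^+ n /\ `|gcoef n.+1| <= (4 * B) ^+ n.+1 by case.
elim: n => [|n [IH1 IH2]].
  rewrite gcoef0 gcoef1 normr1 expr0 expr1 lexx normrN normrM ger0_norm//.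
  by split => //; lra.
split => //.
rewrite -(ler_pM2l (x := n.+2%:R)) ?ltr0n// -[X in X * _ <= _]ger0_norm ?ler0n//.
rewrite -normrM gcoef_rec normrN.
apply: (le_trans (ler_normD _ _)).
rewrite !normrM.
have n0 : 0 <= n%:R :> R by [].
have e1 : `|2 * n.+1%:R + 3| = 2 * n%:R + 5 :> R.
  by rewrite ger0_norm -natr1; [ring|lra].
have e2 : `|n.+1%:R + 2| = n%:R + 3 :> R.
  by rewrite ger0_norm -natr1; [ring|lra].
rewrite e1 e2.
set X := (4 * B) ^+ n in IH1 *.
have X0 : 0 <= X by rewrite exprn_ge0// mulr_ge0.
have -> : (4 * B) ^+ n.+2 = 16 * B ^+ 2 * X by rewrite -(addn2 n) exprD -/X; ring.
have h1 : `|b| * (2 * n%:R + 5) * `|gcoef n.+1| <=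
    B * (2 * n%:R + 5) * (4 * B * X).
  rewrite ler_pM ?mulr_ge0 ?addr_ge0 ?mulr_ge0//.
    by rewrite ler_wpM2r// addr_ge0 ?mulr_ge0.
  by move: IH2; rewrite exprS.
have h2 : `|d| * (n%:R + 3) * `|gcoef n| <= B ^+ 2 * (n%:R + 3) * X.
  rewrite ler_pM ?mulr_ge0 ?addr_ge0//.
  by rewrite ler_wpM2r// addr_ge0.
apply: (le_trans (lerD h1 h2)).
rewrite -subr_ge0.
have -> : n.+2%:R * (16 * B ^+ 2 * X) - (B * (2 * n%:R + 5) * (4 * B * X) +
    B ^+ 2 * (n%:R + 3) * X) = (B ^+ 2 * X) * (7 * n%:R + 9).
  by rewrite -(addn2 n) natrD; ring.
by rewrite !mulr_ge0 ?exprn_ge0 ?addr_ge0 ?mulr_ge0.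
Qed.

Definition gpoly N (t : R) : R := \sum_(n < N) gcoef n * t ^+ n.
Definition dgpoly N (t : R) : R := \sum_(n < N) gcoef n * (n%:R * t ^+ n.-1).
Definition gquad (t : R) : R := 1 + 2 * b * t + d * t ^+ 2.

(* The exact series solves [gquad y' + 3 (b + d t) y = 0]; this is the defect of
   its truncation. *)
Lemma gpoly_ode N t : gquad t * dgpoly N.+1 t + 3 * (b + d * t) * gpoly N.+1 t =
  - (N.+1%:R * gcoef N.+1 * t ^+ N) + d * (N%:R + 3) * gcoef N * t ^+ N.+1.
Proof.
elim: N => [|N IH].
  by rewrite /dgpoly /gpoly !big_ord1 gcoef0 gcoef1 /=; ring.
rewrite /dgpoly /gpoly !(big_ord_recr N.+1) /= -/(dgpoly N.+1 t) -/(gpoly N.+1 t).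
rewrite gcoef_rec.
set D := dgpoly _ _ in IH *; set P := gpoly _ _ in IH *.
have -> : gquad t * (D + gcoef N.+1 * (N.+1%:R * t ^+ N)) +
  3 * (b + d * t) * (P + gcoef N.+1 * t ^+ N.+1) =
  (gquad t * D + 3 * (b + d * t) * P) + (gquad t * (gcoef N.+1 * (N.+1%:R * t ^+ N)) +
  3 * (b + d * t) * (gcoef N.+1 * t ^+ N.+1)) by ring.
by rewrite IH /gquad -!natr1 !exprS; ring.
Qed.

(** Polynomial forms, whose formal derivatives give those of the truncated sums. *)
Let gP N : {poly R} := \sum_(n < N) gcoef n *: 'X^n.
Let gQ : {poly R} := 1 + (2 * b) *: 'X + d *: 'X^2.

Let gPE N t : (gP N).[t] = gpoly N t.
Proof.
by rewrite horner_sum; apply: eq_bigr => i _; rewrite !hornerE.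
Qed.

Let dgPE N t : (gP N)^`().[t] = dgpoly N t.
Proof.
rewrite raddf_sum horner_sum; apply: eq_bigr => i _.
by rewrite /= derivZ derivXn !hornerE /= hornerMn hornerXn; ring.
Qed.

Let gQE t : gQ.[t] = gquad t.
Proof. by rewrite /gquad !hornerE. Qed.

Let dgQE t : gQ^`().[t] = 2 * (b + d * t).
Proof.
rewrite !derivD !derivZ derivX derivXn derivC !hornerE.
by ring.
Qed.

(** For the exact series y one has [y^2 gquad^3 = 1]. Squaring keeps the expression polynomial, and
    its derivative has the defect in [gpoly_ode] as a factor. *)
Lemma is_derive_sqr_gpoly_gquad N (t : R) :
  is_derive t 1 (fun x => gpoly N x ^+ 2 * gquad x ^+ 3)
   (2 * gpoly N t * gquad t ^+ 2 *
    (gquad t * dgpoly N t + 3 * (b + d * t) * gpoly N t)).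
Proof.
have -> : (fun x => gpoly N x ^+ 2 * gquad x ^+ 3) = horner (gP N ^+ 2 * gQ ^+ 3).
  by apply/funext => x; rewrite hornerM !horner_exp gPE gQE.
apply: is_derive_eq.
rewrite derivM !deriv_exp hornerD !hornerM !hornerMn !hornerM !horner_exp dgPE dgQE gPE gQE.
by rewrite /=; ring.
Qed.

(** The terms after the first are dominated by a geometric series of ratio 1/4, whose sum is 1/3. *)
Lemma gpoly_close (B : R) : 0 <= B -> `|b| <= B -> `|d| <= B ^+ 2 ->
  forall N t, 4 * B * `|t| <= 1 / 4 -> 2 / 3 <= gpoly N.+1 t <= 4 / 3.
Proof.
move=> B0 bB dB N t Bt.
have q0 : 0 <= 4 * B * `|t| by rewrite !mulr_ge0.
have -> : gpoly N.+1 t = 1 + \sum_(n < N) gcoef n.+1 * t ^+ n.+1.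
  by rewrite /gpoly big_ord_recl gcoef0 expr0 mulr1.
suff : `|\sum_(n < N) gcoef n.+1 * t ^+ n.+1| <= 1 / 3.
  by rewrite ler_norml => /andP[? ?]; apply/andP; split; lra.
have le1 : `|\sum_(n < N) gcoef n.+1 * t ^+ n.+1| <= \sum_(n < N) (1 / 4) ^+ n.+1.
  apply: (le_trans (ler_norm_sum _ _ _)); apply: ler_sum => i _.
  rewrite normrM normrX.
  apply: (@le_trans _ _ ((4 * B * `|t|) ^+ i.+1)).
    by rewrite [leRHS]exprMn ler_wpM2r ?exprn_ge0// (gcoef_bound (B := B)).
  by rewrite lerXn2r ?nnegrE//; lra.
apply: (le_trans le1).
have -> : \sum_(n < N) (1 / 4) ^+ n.+1 = 1 / 3 * (1 - (1 / 4) ^+ N) :> R.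
  elim: N {le1} => [|N IH]; first by rewrite big_ord0 expr0; ring.
  by rewrite big_ord_recr/= IH exprS; field.
have : 0 <= (1 / 4 : R) ^+ N by rewrite exprn_ge0//; lra.
by lra.
Qed.

Lemma gquad_close (B : R) : 0 <= B -> `|b| <= B -> `|d| <= B ^+ 2 ->
  forall t, 4 * B * `|t| <= 1 / 4 -> 3 / 4 <= gquad t <= 5 / 4.
Proof.
move=> B0 bB dB t Bt.
have q0 : 0 <= B * `|t| by rewrite !mulr_ge0.
have h1 : `|b * t| <= B * `|t| by rewrite normrM ler_wpM2r.
have h2 : `|d * t ^+ 2| <= (B * `|t|) ^+ 2.
  by rewrite normrM normrX exprMn ler_wpM2r// exprn_ge0.
have h3 : (B * `|t|) ^+ 2 <= (1 / 16) ^+ 2 by rewrite lerXn2r ?nnegrE//; lra.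
move: h1 h2; rewrite /gquad -mulrA !ler_norml => /andP[? ?] /andP[? ?].
by apply/andP; split; lra.
Qed.

(* By [gpoly_ode] the derivative of [gpoly^2 gquad^3] is small, so this function
   stays close to its value 1 at 0. *)
Lemma gpoly_expand (B : R) : 0 <= B -> `|b| <= B -> `|d| <= B ^+ 2 ->
  forall N t, 8 * B * `|t| <= 1 / 2 ->
  `|(Num.sqrt (gquad t) ^+ 3)^-1 - gpoly N t| <= 10 * (8 * B * `|t|) ^+ N.
Proof.
move=> B0 bB dB N t Bt.
have Bt0 : 0 <= B * `|t| by rewrite mulr_ge0.
have Qt := @gquad_close B B0 bB dB t ltac:(lra).
set s := Num.sqrt _.
have sQ : s ^+ 2 = gquad t by rewrite sqr_sqrtr; lra.
(* 0.8^2 < 3/4 and 0.8^3 > 1/2; the second bound pays for the final division by [s^3]. *)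
have s8 : 8 / 10 <= s.
  by rewrite -(@ler_pXn2r _ 2) ?nnegrE ?sqrtr_ge0// ?sQ; lra.
have s3 : 1 / 2 <= s ^+ 3.
  apply: (@le_trans _ _ ((8 / 10) ^+ 3)); first by lra.
  by rewrite lerXn2r ?nnegrE ?sqrtr_ge0//; lra.
have s30 : 0 < s ^+ 3 by lra.
case: N => [|N].
  rewrite /gpoly big_ord0 subr0 expr0 ger0_norm ?invr_ge0; last by lra.
  by rewrite invf_ple ?posrE; lra.
have Pt := @gpoly_close B B0 bB dB N t ltac:(lra).
pose E c := - (N.+1%:R * gcoef N.+1 * c ^+ N) + d * (N%:R + 3) * gcoef N * c ^+ N.+1.
have [c [ct cE]] : exists c, `|c| <= `|t| /\
   gpoly N.+1 t ^+ 2 * gquad t ^+ 3 - 1 =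
     2 * gpoly N.+1 c * gquad c ^+ 2 * E c * t.
  have Y0 : gpoly N.+1 0 ^+ 2 * gquad 0 ^+ 3 = 1.
    rewrite /gpoly big_ord_recl gcoef0 big1 => [|i _].
      by rewrite /gquad; ring.
    by rewrite exprS mul0r mulr0.
  pose Y x := gpoly N.+1 x ^+ 2 * gquad x ^+ 3.
  have dY (x : R) : is_derive x 1 Y (2 * gpoly N.+1 x * gquad x ^+ 2 * E x).
    by rewrite /E -gpoly_ode; exact: is_derive_sqr_gpoly_gquad.
  have cY : continuous Y.
    move=> x; apply: differentiable_continuous.
    by apply/derivable1_diffP; case: (dY x).
  have cYA A : {within A, continuous Y} by apply: continuous_subspaceT.
  have [t0|t0] := leP 0 t.
    have [c cI] := MVT_segment t0 (fun x _ => dY x) (cYA _).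
    rewrite subr0 => cE; exists c; split; last by rewrite -cE /Y Y0.
    by move: cI; rewrite in_itv /= => /andP[? ?]; rewrite !ger0_norm.
  have [c cI] := MVT_segment (ltW t0) (fun x _ => dY x) (cYA _).
  rewrite sub0r mulrN => /eqP; rewrite -eqr_oppLR opprB => /eqP cE.
  exists c; split; last by rewrite -cE /Y Y0.
  move: cI; rewrite in_itv /= => /andP[? c0]; rewrite !ler0_norm//; last exact: ltW.
  by rewrite lerN2.
have Btc : 4 * B * `|c| <= 4 * B * `|t| by rewrite ler_wpM2l// mulr_ge0.
have Qc := @gquad_close B B0 bB dB c ltac:(lra).
have Pc := @gpoly_close B B0 bB dB N c ltac:(lra).
set T := 4 * B * `|t|.
have T0 : 0 <= T by rewrite /T; lra.
(* The defect grows like [N.+1]; replacing the ratio [4 B |t|] by [8 B |t|] gains a power of 2,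
   which absorbs it. *)
have Et : `|E c * t| <= 11 / 10 * (8 * B * `|t|) ^+ N.+1.
  have -> : 8 * B * `|t| = 2 * T by rewrite /T; ring.
  have h1 : `|N.+1%:R * gcoef N.+1 * c ^+ N * t| <= N.+1%:R * T ^+ N.+1.
    rewrite !normrM ger0_norm// -!mulrA ler_wpM2l//.
    rewrite /T exprMn ler_pM ?mulr_ge0 ?(gcoef_bound (B := B))//.
    by rewrite normrX exprSr ler_wpM2r// lerXn2r ?nnegrE.
  have h2 : `|d * (N%:R + 3) * gcoef N * c ^+ N.+1 * t| <=
      (N%:R + 3) / 64 * T ^+ N.+1.
    apply: (@le_trans _ _ ((N%:R + 3) / 16 * T ^+ N.+2)).
      have -> : (N%:R + 3) / 16 * T ^+ N.+2 =
          B ^+ 2 * (N%:R + 3) * (4 * B) ^+ N * `|t| ^+ N.+1 * `|t|.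
        by rewrite /T exprMn !(exprSr (4 * B)) !(exprSr `|t|); field.
      have N3 : 0 <= N%:R + 3 :> R by rewrite addr_ge0.
      rewrite !normrM (ger0_norm N3) normrX ler_wpM2r//.
      rewrite ler_pM ?mulr_ge0 ?exprn_ge0//; last by rewrite lerXn2r ?nnegrE.
      by rewrite ler_pM ?mulr_ge0 ?(gcoef_bound (B := B))// ler_wpM2r.
    rewrite [T ^+ N.+2]exprSr mulrCA [leRHS]mulrC ler_wpM2l ?exprn_ge0//.
    have N0 : 0 <= N%:R :> R by [].
    have : (N%:R + 3) * T <= (N%:R + 3) * (1 / 4).
      by rewrite ler_wpM2l ?addr_ge0// /T; lra.
    by lra.
  rewrite /E mulrDl mulNr; apply: (le_trans (ler_normD _ _)); rewrite normrN.
  apply: (le_trans (lerD h1 h2)); rewrite -mulrDl [(2 * T) ^+ _]exprMn [leRHS]mulrA.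
  rewrite ler_wpM2r ?exprn_ge0// exprS.
  have : N.+1%:R <= 2 ^+ N :> R.
    by rewrite -natrX ler_nat ltn_expl.
  have : 0 <= N%:R :> R by [].
  by rewrite -natr1; lra.
set P := gpoly N.+1 t in Pt cE *.
have X1 : `|P * s ^+ 3 - 1| <= 5 * (8 * B * `|t|) ^+ N.+1.
  (* For [a >= 0], [|a - 1| <= |a^2 - 1|]: this undoes the squaring. *)
  apply: (@le_trans _ _ `|(P * s ^+ 3) ^+ 2 - 1|).
    have -> : (P * s ^+ 3) ^+ 2 - 1 = (P * s ^+ 3 - 1) * (P * s ^+ 3 + 1) by ring.
    rewrite normrM ler_peMr//.
    have : 0 <= P * s ^+ 3 by rewrite mulr_ge0; lra.
    by move=> ?; rewrite ger0_norm; lra.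
  have -> : (P * s ^+ 3) ^+ 2 = P ^+ 2 * gquad t ^+ 3 by rewrite -sQ; ring.
  rewrite cE -mulrA normrM.
  have P0 : 0 <= gpoly N.+1 c by lra.
  have Q0 : 0 <= gquad c by lra.
  apply: (@le_trans _ _ ((2 * (4 / 3) * (5 / 4) ^+ 2) * (11 / 10 * (8 * B * `|t|) ^+ N.+1))).
    rewrite ler_pM// ger0_norm; last by rewrite !mulr_ge0 ?exprn_ge0//; lra.
    rewrite ler_pM ?mulr_ge0 ?exprn_ge0//; first by lra.
    by rewrite lerXn2r ?nnegrE//; lra.
  have : 0 <= (8 * B * `|t|) ^+ N.+1 by rewrite exprn_ge0//; lra.
  by lra.
have -> : (s ^+ 3)^-1 - P = - (P * s ^+ 3 - 1) / s ^+ 3.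
  by field; apply/eqP => s0; move: s30; rewrite s0 expr0n ltxx.
rewrite normrM normrN (ger0_norm (x := (s ^+ 3)^-1)) ?invr_ge0; last by lra.
rewrite ler_pdivrMr//; apply: (le_trans X1).
have q0 : 0 <= (8 * B * `|t|) ^+ N.+1 by rewrite exprn_ge0//; lra.
have : (8 * B * `|t|) ^+ N.+1 * (1 / 2) <= (8 * B * `|t|) ^+ N.+1 * s ^+ 3.
  by rewrite ler_wpM2l.
by lra.
Qed.

End Gegenbauer.

(** * Euclidean inner product and norm *)

Section EuclideanLemmas.
Context {R : realType}.
Implicit Types (x y z u v w : point3 R) (a t : R).

Lemma edotDr x y z : edot x (y + z) = edot x y + edot x z.
Proof. by rewrite /edot /=; ring. Qed.

Lemma edotZr x a y : edot x (a *: y) = a * edot x y.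
Proof. by rewrite /edot /= /GRing.scale /=; ring. Qed.

Lemma edot_line w v t :
  edot (w + t *: v) (w + t *: v) = edot w w + 2 * edot w v * t + edot v v * t ^+ 2.
Proof. by rewrite /edot /= /GRing.scale /=; ring. Qed.

Lemma edot_ge0 x : 0 <= edot x x.
Proof. by rewrite /edot !addr_ge0// -expr2 sqr_ge0. Qed.

Lemma enorm_ge0 x : 0 <= enorm x.
Proof. exact: sqrtr_ge0. Qed.

Lemma sqr_enorm x : enorm x ^+ 2 = edot x x.
Proof. by rewrite sqr_sqrtr// edot_ge0. Qed.

Lemma edot_le x y : `|edot x y| <= enorm x * enorm y.
Proof.
rewrite -sqrtrM ?edot_ge0// -sqrtr_sqr ler_wsqrtr//.
rewrite -subr_ge0.
have -> : edot x x * edot y y - edot x y ^+ 2 =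
  (x.1.1 * y.1.2 - x.1.2 * y.1.1) ^+ 2 + (x.1.1 * y.2 - x.2 * y.1.1) ^+ 2 +
  (x.1.2 * y.2 - x.2 * y.1.2) ^+ 2 by rewrite /edot; ring.
by rewrite !addr_ge0// sqr_ge0.
Qed.

Lemma enormZ a x : enorm (a *: x) = `|a| * enorm x.
Proof.
rewrite -(sqrtr_sqr a) -sqrtrM ?sqr_ge0//; congr Num.sqrt.
by rewrite /edot /= /GRing.scale /=; ring.
Qed.

Lemma enormN x : enorm (- x) = enorm x.
Proof. by rewrite -scaleN1r enormZ normrN1 mul1r. Qed.

Lemma enormB x y : enorm (x - y) = enorm (y - x).
Proof. by rewrite -enormN opprB. Qed.

Lemma enormD x y : enorm (x + y) <= enorm x + enorm y.
Proof.
rewrite -(@ler_pXn2r _ 2) ?nnegrE ?addr_ge0 ?enorm_ge0//.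
have -> : (enorm x + enorm y) ^+ 2 =
  enorm x ^+ 2 + enorm y ^+ 2 + 2 * (enorm x * enorm y) by ring.
rewrite !sqr_enorm.
have -> : edot (x + y) (x + y) = edot x x + edot y y + 2 * edot x y.
  by rewrite /edot /=; ring.
by rewrite lerD2l ler_wpM2l// (le_trans (ler_norm _)) ?edot_le.
Qed.

Lemma enormBD x y z : enorm (x - z) <= enorm (x - y) + enorm (y - z).
Proof. by have := enormD (x - y) (y - z); rewrite addrA subrK. Qed.

Lemma enorm0 : enorm (0 : point3 R) = 0.
Proof. by rewrite /enorm /edot /= !mulr0 !addr0 sqrtr0. Qed.

Lemma ler_enormB x y : `|enorm x - enorm y| <= enorm (x - y).
Proof.
have h1 : enorm x <= enorm (x - y) + enorm y.
  by have := enormD (x - y) y; rewrite subrK.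
have h2 : enorm y <= enorm (x - y) + enorm x.
  by rewrite (enormB x y); have := enormD (y - x) x; rewrite subrK.
by rewrite ler_norml; apply/andP; split; lra.
Qed.

End EuclideanLemmas.

(** * Point poles: uniform Taylor estimates and harmonicity *)

Section Kernel.
Context {R : realType}.
Implicit Types (x y u v w : point3 R) (al t : R).

(* The potential at [w] of a charge [al] and a dipole [u] placed at the origin;
   [pole_coef] gives its Taylor coefficients along the line [w + t v]. *)
Definition pole al u w := (al * enorm w ^+ 2 + edot u w) / enorm w ^+ 3.

Definition pole_coef al u w v (n : nat) : R :=
  let C := gcoef (edot w v / enorm w ^+ 2) (edot v v / enorm w ^+ 2) in
  ((al * enorm w ^+ 2 + edot u w) * C n
   + (if n is m.+1 then (2 * al * edot w v + edot u v) * C m else 0)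
   + (if n is m.+2 then al * edot v v * C m else 0)) / enorm w ^+ 3.

Lemma sum_shift (C : nat -> R) c t N :
  \sum_(n < N) (if (n : nat) is m.+1 then c * C m else 0) * t ^+ n =
  c * t * \sum_(n < N.-1) C n * t ^+ n.
Proof.
case: N => [|N]; first by rewrite !big_ord0 mulr0.
rewrite big_ord_recl mul0r add0r mulr_sumr; apply: eq_bigr => i _.
by rewrite lift0 /= exprS; ring.
Qed.

Lemma sum_shift2 (C : nat -> R) c t N :
  \sum_(n < N) (if (n : nat) is m.+2 then c * C m else 0) * t ^+ n =
  c * t ^+ 2 * \sum_(n < N.-2) C n * t ^+ n.
Proof.
case: N => [|[|N]]; rewrite ?big_ord_recl ?big_ord0 ?mul0r ?mulr0 ?addr0//.
rewrite add0r add0r mulr_sumr; apply: eq_bigr => i _.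
by rewrite !lift0 /= exprS exprS; ring.
Qed.

(** Along the line, [|w + t v|] is [|w|] times the square root of [gquad b d t], and the numerator
    is quadratic in [t], with coefficients proportional to [c0], [c1], [c2]. The errors of the three
    products add up to 10 (1 + 1/4 + 1/64) < 13. The bound depends on the pole only through [al0],
    [u0] and [de]. *)
Lemma pole_expand (al0 u0 de : R) : 0 < de -> 0 <= al0 -> 0 <= u0 ->
  forall al u w v V, `|al| <= al0 -> enorm u <= u0 -> de <= enorm w ->
  enorm v <= V -> forall N t, 8 * (V / de) * `|t| <= 1 / 2 ->
  `|pole al u (w + t *: v) - \sum_(n < N) pole_coef al u w v n * t ^+ n| <=
  13 * (al0 / de + u0 / de ^+ 2) * (8 * (V / de) * `|t|) ^+ N.
Proof.
move=> de0 al00 u00 al u w v V alu uu dw vV N t.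
set K := al0 / de + _; set B := V / de; move=> Bt.
have w0 : 0 < enorm w by exact: lt_le_trans dw.
have V0 : 0 <= V by exact: le_trans (enorm_ge0 _) vV.
pose i := (enorm w)^-1; pose j := de^-1.
have i0 : 0 < i by rewrite invr_gt0.
have j0 : 0 < j by rewrite invr_gt0.
have ij : i <= j by rewrite lef_pV2 ?posrE.
have iw : i * enorm w = 1 by rewrite mulVf ?gt_eqF.
have B0 : 0 <= B by rewrite mulr_ge0// ltW.
pose b := edot w v / enorm w ^+ 2; pose d := edot v v / enorm w ^+ 2.
have wv : `|edot w v| <= enorm w * V.
  by rewrite (le_trans (edot_le _ _))// ler_wpM2l ?enorm_ge0.
have bi : b = edot w v * i ^+ 2 by rewrite /b /i exprVn.
have di : d = edot v v * i ^+ 2 by rewrite /d /i exprVn.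
have bB : `|b| <= B.
  rewrite bi normrM [`|i ^+ 2|]ger0_norm ?sqr_ge0//.
  apply: (@le_trans _ _ ((enorm w * V) * i ^+ 2)).
    by rewrite ler_wpM2r ?sqr_ge0.
  have -> : enorm w * V * i ^+ 2 = (i * enorm w) * V * i by ring.
  by rewrite iw mul1r ler_wpM2l.
have vV2 : edot v v <= V ^+ 2.
  by rewrite -sqr_enorm lerXn2r ?nnegrE ?enorm_ge0.
have dB2 : `|d| <= B ^+ 2.
  rewrite di ger0_norm; last by rewrite mulr_ge0 ?edot_ge0 ?sqr_ge0.
  rewrite /B -/j exprMn ler_pM ?edot_ge0 ?sqr_ge0//.
  by rewrite lerXn2r ?nnegrE// ltW.
have S := gpoly_expand B0 bB dB2.
set s := (Num.sqrt (gquad b d t) ^+ 3)^-1 in S.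
have Bt' : 4 * B * `|t| <= 1 / 4 by lra.
have Qt := gquad_close B0 bB dB2 Bt'.
pose c0 := (al * enorm w ^+ 2 + edot u w) * i ^+ 3.
pose c1 := (2 * al * edot w v + edot u v) * i ^+ 3.
pose c2 := al * edot v v * i ^+ 3.
have poleE : pole al u (w + t *: v) = (c0 + c1 * t + c2 * t ^+ 2) * s.
  have nE : enorm (w + t *: v) = enorm w * Num.sqrt (gquad b d t).
    rewrite -[enorm w](ger0_norm (ltW w0)) -sqrtr_sqr -sqrtrM ?sqr_ge0//.
    rewrite [LHS]/enorm edot_line -sqr_enorm; congr Num.sqrt.
    rewrite /gquad /b /d; field; exact: lt0r_neq0.
  rewrite /pole nE (exprMn 2) (@sqr_sqrtr _ (gquad b d t)); last by lra.
  rewrite edotDr edotZr exprMn invfM -/s /gquad -exprVn -/i bi di.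
  have -> : al * (enorm w ^+ 2 * (1 + 2 * (edot w v * i ^+ 2) * t +
      edot v v * i ^+ 2 * t ^+ 2)) = al * (enorm w ^+ 2 + (i * enorm w) ^+ 2 *
      (2 * edot w v * t + edot v v * t ^+ 2)) by ring.
  by rewrite iw /c0 /c1 /c2; ring.
have sumE : \sum_(n < N) pole_coef al u w v n * t ^+ n =
   c0 * gpoly b d N t + c1 * t * gpoly b d N.-1 t + c2 * t ^+ 2 * gpoly b d N.-2 t.
  rewrite /gpoly -sum_shift -sum_shift2 mulr_sumr -!big_split /=.
  apply: eq_bigr => n _; rewrite /pole_coef -/b -/d /c0 /c1 /c2 -exprVn -/i.
  by case: (n : nat) => [|[|m]]; ring.
rewrite poleE sumE.
set T := 8 * B * `|t| in Bt *.
have T0 : 0 <= T by rewrite mulr_ge0// mulr_ge0.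
have T1 : T <= 1 by lra.
have K0 : 0 <= K by rewrite addr_ge0 ?mulr_ge0// ?invr_ge0 ?sqr_ge0// ltW.
have i2j : i ^+ 2 <= j ^+ 2 by rewrite lerXn2r ?nnegrE// ltW.
have i3j : i ^+ 3 <= j ^+ 3 by rewrite lerXn2r ?nnegrE// ltW.
have KE : K = al0 * j + u0 * j ^+ 2 by rewrite /K /j exprVn.
have TE : T = 8 * (V * j) * `|t| by rewrite /T /B /j.
have ih : 0 <= i by exact: ltW.
have jh : 0 <= j by exact: ltW.
have Vt0 : 0 <= V * `|t| by rewrite mulr_ge0.
have c0K : `|c0| <= K.
  have -> : c0 = (i * enorm w) ^+ 2 * al * i + edot u w * i ^+ 3 by rewrite /c0; ring.
  rewrite iw expr1n mul1r KE (le_trans (ler_normD _ _))// lerD//.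
    by rewrite normrM [`|i|]ger0_norm// ler_pM.
  rewrite normrM [`|i ^+ 3|]ger0_norm ?exprn_ge0//.
  apply: (@le_trans _ _ (u0 * enorm w * i ^+ 3)).
    rewrite ler_wpM2r ?exprn_ge0//; apply: (le_trans (edot_le _ _)).
    by rewrite ler_wpM2r// ltW.
  have -> : u0 * enorm w * i ^+ 3 = (i * enorm w) * u0 * i ^+ 2 by ring.
  by rewrite iw mul1r ler_wpM2l.
have c1K : `|c1| * `|t| <= K / 4 * T.
  have i3 : 0 <= i ^+ 3 by rewrite exprn_ge0.
  have : `|c1| <= 2 * al0 * V * i ^+ 2 + u0 * V * i ^+ 3.
    rewrite normrM [`|i ^+ 3|]ger0_norm//.
    have -> : 2 * al0 * V * i ^+ 2 + u0 * V * i ^+ 3 =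
      (2 * al0 * (enorm w * V) + u0 * V) * i ^+ 3.
      have -> : (2 * al0 * (enorm w * V) + u0 * V) * i ^+ 3 =
        (i * enorm w) * 2 * al0 * V * i ^+ 2 + u0 * V * i ^+ 3 by ring.
      by rewrite iw; ring.
    rewrite ler_wpM2r// (le_trans (ler_normD _ _))// lerD//.
      by rewrite normrM ler_pM// normrM ger0_norm// ler_wpM2l.
    by rewrite (le_trans (edot_le _ _))// ler_pM ?enorm_ge0.
  move=> /(ler_wpM2r (normr_ge0 t)) h; apply: (le_trans h).
  rewrite KE TE.
  have -> : (2 * al0 * V * i ^+ 2 + u0 * V * i ^+ 3) * `|t| =
    (V * `|t|) * (2 * al0 * i ^+ 2 + u0 * i ^+ 3) by ring.
  have -> : (al0 * j + u0 * j ^+ 2) / 4 * (8 * (V * j) * `|t|) =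
    (V * `|t|) * (2 * al0 * j ^+ 2 + 2 * u0 * j ^+ 3) by field.
  rewrite ler_wpM2l// lerD//; first by rewrite ler_wpM2l// mulr_ge0.
  by rewrite ler_pM// mulr_natl mulr2n lerDl.
have c2K : `|c2| * `|t| ^+ 2 <= K / 64 * T ^+ 2.
  have i3 : 0 <= i ^+ 3 by rewrite exprn_ge0.
  have : `|c2| <= al0 * V ^+ 2 * j ^+ 3.
    rewrite /c2 normrM [`|i ^+ 3|]ger0_norm// ler_pM// normrM ler_pM//.
    by rewrite ger0_norm ?edot_ge0.
  have t2 : 0 <= `|t| ^+ 2 by rewrite exprn_ge0.
  move=> /(ler_wpM2r t2) h; apply: (le_trans h).
  rewrite KE TE.
  have -> : al0 * V ^+ 2 * j ^+ 3 * `|t| ^+ 2 = V ^+ 2 * `|t| ^+ 2 * j ^+ 2 * (al0 * j) by ring.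
  have -> : (al0 * j + u0 * j ^+ 2) / 64 * (8 * (V * j) * `|t|) ^+ 2 =
    V ^+ 2 * `|t| ^+ 2 * j ^+ 2 * (al0 * j + u0 * j ^+ 2) by field.
  by rewrite ler_wpM2l ?mulr_ge0 ?exprn_ge0// lerDl mulr_ge0 ?exprn_ge0.
have -> : (c0 + c1 * t + c2 * t ^+ 2) * s - (c0 * gpoly b d N t +
    c1 * t * gpoly b d N.-1 t + c2 * t ^+ 2 * gpoly b d N.-2 t) =
  c0 * (s - gpoly b d N t) + c1 * t * (s - gpoly b d N.-1 t) +
  c2 * t ^+ 2 * (s - gpoly b d N.-2 t) by ring.
(* [N - k] is truncated, so the exponents may add up to more than [N]; this is where [T <= 1]
   enters. *)
have TN k : T ^+ k * T ^+ (N - k) <= T ^+ N.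
  by rewrite -exprD ler_wiXn2l// -leq_subLR.
have e0 : `|c0 * (s - gpoly b d N t)| <= K * (10 * T ^+ N).
  by rewrite normrM ler_pM// S.
have e1 : `|c1 * t * (s - gpoly b d N.-1 t)| <= K / 4 * (10 * T ^+ N).
  rewrite normrM (normrM c1 t); apply: (@le_trans _ _ (K / 4 * T * (10 * T ^+ N.-1))).
    by apply: ler_pM; rewrite ?mulr_ge0//; exact: S.
  have := TN 1; rewrite expr1 subn1 => h.
  have -> : K / 4 * T * (10 * T ^+ N.-1) = K / 4 * (10 * (T * T ^+ N.-1)) by ring.
  by rewrite ler_wpM2l ?divr_ge0// ler_wpM2l.
have e2 : `|c2 * t ^+ 2 * (s - gpoly b d N.-2 t)| <= K / 64 * (10 * T ^+ N).
  rewrite normrM (normrM c2) normrX; apply: (@le_trans _ _ (K / 64 * T ^+ 2 * (10 * T ^+ N.-2))).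
    by apply: ler_pM; rewrite ?mulr_ge0//; exact: S.
  have := TN 2; rewrite subn2 => h.
  have -> : K / 64 * T ^+ 2 * (10 * T ^+ N.-2) = K / 64 * (10 * (T ^+ 2 * T ^+ N.-2)) by ring.
  by rewrite ler_wpM2l ?divr_ge0// ler_wpM2l.
apply: (le_trans (ler_normD _ _)); apply: (le_trans (lerD (ler_normD _ _) e2)).
apply: (le_trans (lerD (lerD e0 e1) (lexx _))).
have : 0 <= K * T ^+ N by rewrite mulr_ge0// exprn_ge0.
by lra.
Qed.

Lemma pole_coef0 al u w v : pole_coef al u w v 0 = pole al u w.
Proof. by rewrite /pole_coef gcoef0 !addr0 mulr1. Qed.

Definition axes : seq (point3 R) := [:: (1, 0, 0); (0, 1, 0); (0, 0, 1)].

Lemma axes_enorm e : e \in axes -> enorm e = 1.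
Proof.
by rewrite !inE => /or3P[] /eqP ->;
  rewrite /enorm /edot /= ?(mulr0, mulr1, addr0, add0r) sqrtr1.
Qed.

(** Each term is half a second directional derivative, so the sum is half the Laplacian: charge and
    dipole potentials are harmonic off the pole. *)
Lemma pole_laplacian al u w : 0 < enorm w ->
  \sum_(e <- axes) pole_coef al u w e 2 = 0.
Proof.
move=> w0; rewrite !big_cons big_nil /pole_coef !gcoef_2 !gcoef1 !gcoef0.
have : edot w w != 0 by rewrite -sqr_enorm expf_neq0// gt_eqF.
rewrite /= sqr_enorm addr0 -!mulrDl => ww0.
apply/eqP; rewrite mulf_eq0; apply/orP; left; apply/eqP; move: ww0.
move: w u {w0} => [[w1 w2] w3] [[u1 u2] u3]; rewrite /edot /= => w0.
by field.
Qed.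

Lemma pole_bound (al0 u0 : R) al u w : `|al| <= al0 -> enorm u <= u0 ->
  0 < enorm w -> `|pole al u w| <= al0 / enorm w + u0 / enorm w ^+ 2.
Proof.
move=> alu uu w0; have al00 : 0 <= al0 by exact: le_trans alu.
have -> : pole al u w = al / enorm w + edot u w / enorm w ^+ 3.
  by rewrite /pole; field; rewrite gt_eqF.
rewrite (le_trans (ler_normD _ _))// lerD//.
  rewrite normrM [`|(enorm w)^-1|]ger0_norm ?invr_ge0 ?enorm_ge0//.
  by rewrite ler_wpM2r ?invr_ge0 ?enorm_ge0.
rewrite normrM [`|(enorm w ^+ 3)^-1|]ger0_norm ?invr_ge0 ?exprn_ge0 ?enorm_ge0//.
rewrite ler_pdivrMr ?exprn_gt0//.
have -> : u0 / enorm w ^+ 2 * enorm w ^+ 3 = u0 * enorm w.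
  by field; rewrite gt_eqF.
by rewrite (le_trans (edot_le _ _))// ler_wpM2r ?enorm_ge0.
Qed.

Lemma pole_lipschitz (al0 u0 de : R) al u w v : 0 < de ->
  `|al| <= al0 -> enorm u <= u0 -> de <= enorm w ->
  8 * (enorm v / de) <= 1 / 2 ->
  `|pole al u (w + v) - pole al u w| <=
  13 * (al0 / de + u0 / de ^+ 2) * (8 * (enorm v / de)).
Proof.
move=> de0 alu uu dw vd.
have al00 : 0 <= al0 by exact: le_trans alu.
have u00 : 0 <= u0 by exact: le_trans (enorm_ge0 _) uu.
move: (pole_expand de0 al00 u00 alu uu dw (lexx (enorm v))) => /(_ 1%N 1).
rewrite normr1 mulr1 expr1 big_ord1 expr0 mulr1 scale1r pole_coef0.
exact.
Qed.

(** Between [t] and [- t] the odd orders cancel, [pole_laplacian] kills order two, and six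
    remainders of order four are left: 78 is 6 times 13. *)
Lemma pole_mean (al0 u0 de : R) al u w t : 0 < de ->
  `|al| <= al0 -> enorm u <= u0 -> de <= enorm w ->
  8 * de^-1 * `|t| <= 1 / 2 ->
  `|\sum_(e <- axes) (pole al u (w + t *: e) + pole al u (w + (- t) *: e))
    - 6 * pole al u w| <=
  78 * (al0 / de + u0 / de ^+ 2) * (8 * de^-1 * `|t|) ^+ 4.
Proof.
move=> de0 alu uu dw td.
have al00 : 0 <= al0 by exact: le_trans alu.
have u00 : 0 <= u0 by exact: le_trans (enorm_ge0 _) uu.
have w0 : 0 < enorm w by exact: lt_le_trans dw.
have E e s : e \in axes -> `|s| = `|t| ->
    `|pole al u (w + s *: e) - \sum_(n < 4) pole_coef al u w e n * s ^+ n| <=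
    13 * (al0 / de + u0 / de ^+ 2) * (8 * de^-1 * `|t|) ^+ 4.
  move=> /axes_enorm e1 st; have e1' : enorm e <= 1 by rewrite e1.
  move: (pole_expand de0 al00 u00 alu uu dw e1') => /(_ 4%N s).
  by rewrite (div1r de) st; apply.
have L := pole_laplacian al u w0.
have -> : \sum_(e <- axes) (pole al u (w + t *: e) + pole al u (w + (- t) *: e))
    - 6 * pole al u w =
  \sum_(e <- axes) (
    (pole al u (w + t *: e) - \sum_(n < 4) pole_coef al u w e n * t ^+ n) +
    (pole al u (w + (- t) *: e) - \sum_(n < 4) pole_coef al u w e n * (- t) ^+ n)).
  apply/eqP; rewrite -subr_eq0; apply/eqP.
  transitivity (2 * t ^+ 2 * \sum_(e <- axes) pole_coef al u w e 2); last first.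
    by rewrite L mulr0.
  rewrite !big_cons !big_nil !big_ord_recr !big_ord0 /=.
  by rewrite !pole_coef0; ring.
apply: (le_trans (ler_norm_sum _ _ _)).
apply: (@le_trans _ _ (\sum_(e <- axes)
   (26 * (al0 / de + u0 / de ^+ 2) * (8 * de^-1 * `|t|) ^+ 4))); last first.
  by rewrite !big_cons big_nil; lra.
rewrite big_seq [leRHS]big_seq; apply: ler_sum => e eA.
apply: (le_trans (ler_normD _ _)).
have := E e t eA erefl; have := E e (- t) eA (normrN t).
by lra.
Qed.

End Kernel.

(** * Uniform distance to a space of functions *)

Section UniformDistance.
Context {R : realType} {I : Type}.
Variables (K : set I) (V : set (I -> R)).
Hypothesis V0 : V (fun=> 0).
Hypothesis VD : forall a b f g, V f -> V g -> V (fun i => a * f i + b * g i).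
Implicit Types (e f : I -> R) (s : R).

(** [0 <= s] keeps the set of admissible errors bounded below even for empty [K]. *)
Definition approx s e :=
  0 <= s /\ exists2 f, V f & forall i, K i -> `|e i - f i| <= s.

(** If no [s] is admissible, this is the infimum of the empty set, which is 0; the hypotheses
    [ubounded] below exclude that spurious value. *)
Definition dist e : R := inf [set s | approx s e].

Definition ubounded e := exists M : R, forall i, K i -> `|e i| <= M.

Lemma ubounded_approx e : ubounded e -> exists s, approx s e.
Proof.
case=> M eM; exists (Num.max M 0); split; first by rewrite le_max lexx orbT.
by exists (fun=> 0) => // i Ki; rewrite subr0 le_max eM.
Qed.

Let lb e : has_lbound [set s | approx s e].
Proof. by exists 0 => s []. Qed.

Lemma dist_ge0 e : 0 <= dist e.
Proof.
have [h|h] := pselect (exists s, approx s e).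
  by apply: lb_le_inf => //= s [].
by rewrite /dist [X in inf X](_ : _ = set0) ?inf0// -subset0 => s hs; apply: h; exists s.
Qed.

Lemma dist_le s e : approx s e -> dist e <= s.
Proof. by move=> h; exact: ge_inf. Qed.

Lemma dist_lt s e : ubounded e -> dist e < s -> approx s e.
Proof.
move=> /ubounded_approx e0 es.
have [|t [t0 [f Vf tf]] ts] := @inf_adherent _ [set s | approx s e] (s - dist e) _ (conj e0 (lb e)).
  by rewrite subr_gt0.
rewrite -/(dist e) subrKC in ts.
split; first exact: le_trans (ltW ts).
by exists f => // i Ki; rewrite (le_trans (tf _ Ki))// ltW.
Qed.

Lemma dist_le_norm M e : 0 <= M -> (forall i, K i -> `|e i| <= M) -> dist e <= M.
Proof.
move=> M0 eM; apply: dist_le; split=> //.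
by exists (fun=> 0) => // i Ki; rewrite subr0 eM.
Qed.

Lemma uboundedD e f : ubounded e -> ubounded f -> ubounded (fun i => e i + f i).
Proof.
move=> [M eM] [N fN]; exists (M + N) => i Ki.
by rewrite (le_trans (ler_normD _ _))// lerD ?eM ?fN.
Qed.

Lemma uboundedZ a e : ubounded e -> ubounded (fun i => a * e i).
Proof.
move=> [M eM]; exists (`|a| * M) => i Ki.
by rewrite normrM ler_wpM2l// eM.
Qed.

Lemma distD e f : ubounded e -> ubounded f ->
  dist (fun i => e i + f i) <= dist e + dist f.
Proof.
move=> be bf; apply/ler_addgt0Pr => s s0.
have s20 : 0 < s / 2 by rewrite divr_gt0.
have [he [e' Ve' ee']] : approx (dist e + s / 2) e by apply: dist_lt; rewrite ?ltrDl.
have [hf [f' Vf' ff']] : approx (dist f + s / 2) f by apply: dist_lt; rewrite ?ltrDl.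
have -> : dist e + dist f + s = dist e + s / 2 + (dist f + s / 2) by field.
apply: dist_le; split; first exact: addr_ge0.
exists (fun i => 1 * e' i + 1 * f' i) => [|i Ki]; first exact: VD.
rewrite !mul1r opprD addrACA (le_trans (ler_normD _ _))//.
by rewrite lerD// ?ee' ?ff'.
Qed.

Lemma distZ a e : ubounded e -> dist (fun i => a * e i) <= `|a| * dist e.
Proof.
move=> be; apply/ler_addgt0Pr => s s0.
have a1 : 0 < `|a| + 1 by rewrite ltr_wpDl.
have sa : 0 < s / (`|a| + 1) by rewrite divr_gt0.
have [he [e' Ve' ee']] : approx (dist e + s / (`|a| + 1)) e.
  by apply: dist_lt; rewrite ?ltrDl.
apply: (@le_trans _ _ (`|a| * (dist e + s / (`|a| + 1)))).
  apply: dist_le; split; first by rewrite mulr_ge0.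
  exists (fun i => a * e' i + 0 * e' i) => [|i Ki]; first exact: VD.
  by rewrite mul0r addr0 -mulrBr normrM ler_wpM2l// ee'.
rewrite mulrDr lerD2l mulrA ler_pdivrMr// mulrC ler_wpM2l ?(ltW s0)//.
by rewrite lerDl.
Qed.

Lemma dist_perturb M e f : ubounded e -> 0 <= M ->
  (forall i, K i -> `|f i - e i| <= M) -> dist f <= dist e + M.
Proof.
move=> be M0 fe.
have -> : f = (fun i => e i + (f i - e i)) by apply/funext => i; rewrite subrKC.
apply: (le_trans (distD be _)); first by exists M.
by rewrite lerD2l; apply: dist_le_norm.
Qed.

Lemma eq_dist e f : ubounded e -> (forall i, K i -> e i = f i) -> dist e = dist f.
Proof.
move=> be ef; apply/eqP; rewrite eq_le; apply/andP; split.
  rewrite -[leRHS]addr0; apply: dist_perturb => //.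
    by case: be => M eM; exists M => i Ki; rewrite -ef// eM.
  by move=> i Ki; rewrite ef// subrr normr0.
rewrite -[leRHS]addr0; apply: dist_perturb => // i Ki.
by rewrite ef// subrr normr0.
Qed.

Lemma ubounded_sum (J : eqType) (r : seq J) (F : J -> I -> R) :
  (forall j, j \in r -> ubounded (F j)) ->
  ubounded (fun i => \sum_(j <- r) F j i).
Proof.
elim: r => [_|j r IH bF].
  by exists 0 => i _; rewrite big_nil normr0.
have -> : (fun i => \sum_(k <- j :: r) F k i) = (fun i => F j i + \sum_(k <- r) F k i).
  by apply/funext => i; rewrite big_cons.
apply: uboundedD; first by apply: bF; rewrite mem_head.
by apply: IH => k kr; apply: bF; rewrite in_cons kr orbT.
Qed.

Lemma dist_sum (J : eqType) (r : seq J) (F : J -> I -> R) :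
  (forall j, j \in r -> ubounded (F j)) ->
  dist (fun i => \sum_(j <- r) F j i) <= \sum_(j <- r) dist (F j).
Proof.
elim: r => [_|j r IH bF].
  by rewrite big_nil; apply: dist_le_norm => // i _; rewrite big_nil normr0.
have -> : (fun i => \sum_(k <- j :: r) F k i) = (fun i => F j i + \sum_(k <- r) F k i).
  by apply/funext => i; rewrite big_cons.
have bFr k : k \in r -> ubounded (F k) by move=> kr; apply: bF; rewrite in_cons kr orbT.
rewrite big_cons (le_trans (distD _ _))//; first by apply: bF; rewrite mem_head.
  exact: ubounded_sum.
by rewrite lerD2l IH.
Qed.

End UniformDistance.

Lemma le0_geometric {R : realType} (D C : R) : 0 <= C ->
  (forall N, D <= C * (1 / 2) ^+ N) -> D <= 0.
Proof.
move=> C0 DC; rewrite leNgt; apply/negP => D0.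
have CD0 : 0 <= C / D by rewrite divr_ge0// ltW.
have := archi_boundP CD0; set N := Num.bound _.
rewrite ltr_pdivrMr// => CN.
have := DC N; rewrite expr_div_n expr1n div1r ler_pdivlMr ?exprn_gt0// => DN.
have : D * 2 ^+ N < N%:R * D by exact: le_lt_trans CN.
rewrite mulrC ltr_pM2r// ltNge => /negP; apply.
by rewrite -natrX ler_nat ltnW// ltn_expl.
Qed.

(** * Distance of the kernels to a subspace: regularity and continuation in the pole *)

Notation pole_data R := (R * point3 R * point3 R)%type.

Section MaskedKernel.
Context {R : realType}.

(* A point [i] stands for a charge [i.1.1] and a dipole [i.1.2] placed at [i.2]. *)
Definition kern (x : point3 R) (i : pole_data R) := pole i.1.1 i.1.2 (x - i.2).

(** With the mask 1 and the outer and inner masks, the kernels W0 + W1, W0 and W1 all live on one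
    set of poles, so that a single distance compares them. *)
Definition mkern (c : pole_data R -> R) x := fun i => c i * kern x i.

Variables (K : set (pole_data R)) (V : set (pole_data R -> R)).
Hypothesis V0 : V (fun=> 0).
Hypothesis VD : forall a b f g, V f -> V g -> V (fun i => a * f i + b * g i).
Variables (al0 u0 : R).
Hypothesis K_al : forall i, K i -> `|i.1.1| <= al0.
Hypothesis K_u : forall i, K i -> enorm i.1.2 <= u0.
Hypotheses (al0_ge0 : 0 <= al0) (u0_ge0 : 0 <= u0).
Variable c : pole_data R -> R.
Hypothesis c_le1 : forall i, `|c i| <= 1.

(** Poles of zero mask are ignored: [x] may be arbitrarily near to them, since their values are
    multiplied by 0. *)
Definition away de x := forall i, K i -> c i != 0 -> de <= enorm (x - i.2).

Variables (de : R) (x : point3 R).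
Hypotheses (de_gt0 : 0 < de) (xaway : away de x).
Let C := 13 * (al0 / de + u0 / de ^+ 2).
Let d := dist K V.

Let C_ge0 : 0 <= C.
Proof. by rewrite !mulr_ge0 ?addr_ge0 ?divr_ge0 ?exprn_ge0// ltW. Qed.

Let mkern_le M (F : pole_data R -> R) : 0 <= M ->
  (forall i, K i -> c i != 0 -> `|F i| <= M) ->
  forall i, K i -> `|c i * F i| <= M.
Proof.
move=> M0 FM i Ki; have [->|c0] := eqVneq (c i) 0; first by rewrite mul0r normr0.
by rewrite normrM (le_trans _ (FM _ Ki c0))// ler_piMl.
Qed.

Lemma dist_mkern_le : d (mkern c x) <= al0 / de + u0 / de ^+ 2.
Proof.
have K0 : 0 <= al0 / de + u0 / de ^+ 2.
  by rewrite addr_ge0 ?divr_ge0 ?exprn_ge0// ltW.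
apply: dist_le_norm => //; apply: mkern_le => // i Ki ci.
have dw := xaway Ki ci; have w0 := lt_le_trans de_gt0 dw.
rewrite (le_trans (pole_bound (K_al Ki) (K_u Ki) w0))//.
by rewrite lerD// ler_wpM2l// lef_pV2 ?posrE ?exprn_gt0// lerXn2r ?nnegrE// ltW.
Qed.

Lemma ubounded_mkern : ubounded K (mkern c x).
Proof.
have K0 : 0 <= al0 / de + u0 / de ^+ 2.
  by rewrite addr_ge0 ?divr_ge0 ?exprn_ge0// ltW.
exists (al0 / de + u0 / de ^+ 2); apply: mkern_le => // i Ki ci.
have dw := xaway Ki ci; have w0 := lt_le_trans de_gt0 dw.
rewrite (le_trans (pole_bound (K_al Ki) (K_u Ki) w0))//.
by rewrite lerD// ler_wpM2l// lef_pV2 ?posrE ?exprn_gt0// lerXn2r ?nnegrE// ltW.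
Qed.

Lemma mkern_lipschitz v i : K i -> 8 * (enorm v / de) <= 1 / 2 ->
  `|mkern c (x + v) i - mkern c x i| <= C * (8 * (enorm v / de)).
Proof.
move=> Ki vd; rewrite /mkern -mulrBr.
apply: (mkern_le (F := fun i => kern (x + v) i - kern x i)) => //.
  by rewrite mulr_ge0// mulr_ge0// divr_ge0 ?enorm_ge0// ltW.
move=> {Ki}j Kj cj; rewrite /kern addrAC.
by apply: pole_lipschitz => //; [exact: K_al|exact: K_u|exact: xaway].
Qed.

Lemma ubounded_mkernD v : 8 * (enorm v / de) <= 1 / 2 -> ubounded K (mkern c (x + v)).
Proof.
move=> vd; have [M hM] := ubounded_mkern.
exists (C * (8 * (enorm v / de)) + M) => i Ki.
rewrite -(subrK (mkern c x i) (mkern c (x + v) i)) (le_trans (ler_normD _ _))//.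
by rewrite lerD ?hM// mkern_lipschitz.
Qed.

Lemma dist_mkern_lipschitz v : 8 * (enorm v / de) <= 1 / 2 ->
  `|d (mkern c (x + v)) - d (mkern c x)| <= C * (8 * (enorm v / de)).
Proof.
move=> vd.
have M0 : 0 <= C * (8 * (enorm v / de)).
  by rewrite mulr_ge0// mulr_ge0// divr_ge0 ?enorm_ge0// ltW.
rewrite ler_distl lerBlDr; apply/andP; split.
  apply: (dist_perturb V0 VD) => //.
    exact: ubounded_mkernD.
  by move=> i Ki; rewrite distrC; exact: mkern_lipschitz.
apply: (dist_perturb V0 VD) => //; first exact: ubounded_mkern.
by move=> i Ki; exact: mkern_lipschitz.
Qed.

Lemma dist_mkern_mean t : 8 * de^-1 * `|t| <= 1 / 2 ->
  6 * d (mkern c x) <=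
  \sum_(e <- axes) (d (mkern c (x + t *: e)) + d (mkern c (x + (- t) *: e))) +
  6 * C * (8 * de^-1 * `|t|) ^+ 4.
Proof.
move=> td.
have bde s e : e \in axes -> `|s| = `|t| -> ubounded K (mkern c (x + s *: e)).
  move=> /axes_enorm e1 st; apply: ubounded_mkernD.
  by rewrite enormZ e1 mulr1 st [`|t| / de]mulrC mulrA.
pose S i := \sum_(e <- axes) (mkern c (x + t *: e) i + mkern c (x + (- t) *: e) i).
have err i : K i -> `|6 * mkern c x i - S i| <= 6 * C * (8 * de^-1 * `|t|) ^+ 4.
  move=> Ki.
  have -> : 6 * mkern c x i - S i = c i * (6 * kern x i -
      \sum_(e <- axes) (kern (x + t *: e) i + kern (x + (- t) *: e) i)).
    rewrite /S mulrBr mulr_sumr; congr (_ - _); first by rewrite /mkern; ring.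
    by apply: eq_bigr => e _; rewrite mulrDr.
  apply: (mkern_le (F := fun i => 6 * kern x i -
      \sum_(e <- axes) (kern (x + t *: e) i + kern (x + (- t) *: e) i))) => //.
    rewrite mulr_ge0 ?(mulr_ge0 _ C_ge0)// exprn_ge0// mulr_ge0// mulr_ge0//.
    by rewrite invr_ge0 ltW.
  move=> {Ki} j Kj cj; rewrite distrC.
  under eq_bigr do rewrite /kern 2!(addrAC x _ (- j.2)).
  have := pole_mean de_gt0 (K_al Kj) (K_u Kj) (xaway Kj cj) td.
  by rewrite /C !mulrA -natrM.
have bF e : e \in axes ->
    ubounded K (fun i => mkern c (x + t *: e) i + mkern c (x + (- t) *: e) i).
  by move=> eA; apply: uboundedD; apply: bde => //; rewrite normrN.
have bS : ubounded K S by exact: ubounded_sum.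
(* Homogeneity as an equality: [distZ] is applied with the factor 6 and with its inverse. *)
have -> : 6 * d (mkern c x) = d (fun i => 6 * mkern c x i).
  apply/eqP; rewrite eq_le; apply/andP; split; last first.
    apply: (le_trans (distZ V0 VD _ _)); first exact: ubounded_mkern.
    by rewrite ger0_norm.
  rewrite -ler_pdivlMl//.
  have -> : d (mkern c x) = d (fun i => 6^-1 * (6 * mkern c x i)).
    by rewrite /d; congr dist; apply/funext => i; rewrite mulKf.
  apply: (le_trans (distZ V0 VD _ _)); first exact/uboundedZ/ubounded_mkern.
  by rewrite ger0_norm.
apply: (le_trans (dist_perturb V0 VD bS _ err)).
  rewrite mulr_ge0 ?(mulr_ge0 _ C_ge0)// exprn_ge0// mulr_ge0// mulr_ge0//.
  by rewrite invr_ge0 ltW.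
rewrite lerD2r; apply: (le_trans (dist_sum V0 VD bF)).
rewrite big_seq [leRHS]big_seq; apply: ler_sum => e eA.
by apply: distD => //; apply: bde => //; rewrite normrN.
Qed.

(* By induction on the order, every Taylor coefficient of [mkern] along the line
   is at distance 0 from [V]. *)
Lemma dist_mkern_continuation v eta : 0 < eta ->
  (forall t, 0 < t < eta -> d (mkern c (x + t *: v)) = 0) ->
  forall t, 8 * (enorm v / de) * `|t| <= 1 / 2 -> d (mkern c (x + t *: v)) = 0.
Proof.
move=> eta0 F0.
set B := 8 * (enorm v / de).
have B0 : 0 <= B by rewrite mulr_ge0// divr_ge0 ?enorm_ge0// ltW.
pose a n i := c i * pole_coef i.1.1 i.1.2 (x - i.2) v n.
have Rem N t i : K i -> B * `|t| <= 1 / 2 ->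
    `|mkern c (x + t *: v) i - \sum_(n < N) t ^+ n * a n i| <= C * (B * `|t|) ^+ N.
  move=> Ki Bt.
  have -> : mkern c (x + t *: v) i - \sum_(n < N) t ^+ n * a n i =
     c i * (pole i.1.1 i.1.2 ((x - i.2) + t *: v) -
       \sum_(n < N) pole_coef i.1.1 i.1.2 (x - i.2) v n * t ^+ n).
    rewrite mulrBr; congr (_ - _); first by rewrite /mkern /kern addrAC.
    by rewrite mulr_sumr; apply: eq_bigr => n _; rewrite /a; ring.
  apply: (mkern_le (F := fun i => pole i.1.1 i.1.2 ((x - i.2) + t *: v) -
       \sum_(n < N) pole_coef i.1.1 i.1.2 (x - i.2) v n * t ^+ n)) => //.
    by rewrite mulr_ge0// exprn_ge0// mulr_ge0.
  move=> {Ki} j Kj cj; apply: pole_expand => //; [exact: K_al|exact: K_u|exact: xaway].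
(* Up to [t0] both the vanishing of [dist] and the expansion are available. *)
pose t0 := Num.min (eta / 2) (2 * (B + 1))^-1.
have B10 : 0 < 2 * (B + 1) by rewrite mulr_gt0// ltr_wpDl.
have t00 : 0 < t0 by rewrite lt_min divr_gt0//= invr_gt0.
have Bt0 t : 0 < t <= t0 -> B * `|t| <= 1 / 2.
  move=> /andP[t_gt0]; rewrite le_min gtr0_norm// => /andP[_ tB].
  apply: (@le_trans _ _ ((B + 1) * (2 * (B + 1))^-1)).
    by rewrite ler_pM ?(ltW t_gt0)// lerDl.
  by rewrite le_eqVlt; apply/orP; left; apply/eqP; field; rewrite gt_eqF// ltr_wpDl.
have F0' t : 0 < t <= t0 -> d (mkern c (x + t *: v)) = 0.
  move=> /andP[t_gt0]; rewrite le_min => /andP[te _]; apply: F0.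
  by rewrite t_gt0 (le_lt_trans te)// ltr_pdivrMr// ltr_pMr// ltr1n.
have bF t : B * `|t| <= 1 / 2 -> ubounded K (mkern c (x + t *: v)).
  move=> Bt; apply: ubounded_mkernD.
  by rewrite enormZ -mulrA mulrCA mulrC -/B.
(* [t0^n] times the coefficient is the difference of two consecutive remainders, each bounded by
   [C]. *)
have ba n : ubounded K (a n).
  exists (t0 ^- n * (2 * C)) => i Ki.
  have tn : 0 < t0 ^+ n by rewrite exprn_gt0.
  rewrite ler_pdivlMl// -(ger0_norm (ltW tn)) -normrM.
  have tt : 0 < t0 <= t0 by rewrite t00 lexx.
  have h1 := Rem n t0 i Ki (Bt0 _ tt); have h2 := Rem n.+1 t0 i Ki (Bt0 _ tt).
  have -> : t0 ^+ n * a n i =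
    (mkern c (x + t0 *: v) i - \sum_(n < n) t0 ^+ n * a n i) -
    (mkern c (x + t0 *: v) i - \sum_(n < n.+1) t0 ^+ n * a n i).
    by rewrite big_ord_recr/=; ring.
  have le1 k : C * (B * `|t0|) ^+ k <= C.
    have BT := Bt0 _ tt.
    have BT0 : 0 <= B * `|t0| by rewrite mulr_ge0.
    have BT1 : B * `|t0| <= 1 by lra.
    by rewrite ler_piMr// exprn_ile1.
  have -> : 2 * C = C + C by ring.
  rewrite (le_trans (ler_normB _ _))// lerD//.
    exact: le_trans h1 (le1 _).
  exact: le_trans h2 (le1 _).
have bsum N t : ubounded K (fun i => \sum_(n < N) t ^+ n * a n i).
  by apply: ubounded_sum => n _; apply: uboundedZ.
have dsum N t : (forall n, (n < N)%N -> d (a n) = 0) ->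
    d (fun i => \sum_(n < N) t ^+ n * a n i) <= 0.
  move=> a0; apply: (le_trans (dist_sum V0 VD (F := fun (n : 'I_N) i => t ^+ n * a n i) _)).
    by move=> n _; exact: uboundedZ.
  apply: sumr_le0 => n _; apply: (le_trans (distZ V0 VD _ _)) => //.
  by rewrite -/d a0// mulr0.
(* The lower coefficients and the kernel itself are at distance 0, so the term of order [n] is
   controlled by the next remainder: [t^n D <= C (B t)^(n+1)]. For small [t] this contradicts
   [D > 0]. *)
have da n : d (a n) = 0.
  elim/ltn_ind: n => n IH.
  apply/eqP; rewrite eq_le dist_ge0 andbT leNgt; apply/negP => D0.
  set D := d (a n) in D0.
  have CB0 : 0 <= C * B ^+ n.+1 by rewrite mulr_ge0// exprn_ge0.
  pose t := Num.min t0 (D / (2 * (C * B ^+ n.+1 + 1))).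
  have q0 : 0 < 2 * (C * B ^+ n.+1 + 1) by rewrite mulr_gt0// ltr_wpDl.
  have t_gt0 : 0 < t by rewrite lt_min t00 divr_gt0.
  have tt : 0 < t <= t0 by rewrite t_gt0 ge_min lexx.
  have h : d (fun i => t ^+ n * a n i) <= C * (B * `|t|) ^+ n.+1.
    rewrite -[leRHS]add0r -{1}(addr0 0) -{1}(F0' _ tt).
    apply: (le_trans (y := d (fun i => mkern c (x + t *: v) i +
        (-1) * \sum_(n < n) t ^+ n * a n i) + C * (B * `|t|) ^+ n.+1)).
      apply: (dist_perturb V0 VD).
      - by apply: uboundedD; [exact/bF/Bt0|exact/uboundedZ/bsum].
      - by rewrite mulr_ge0// exprn_ge0// mulr_ge0.
      - move=> i Ki; rewrite distrC.
        have := Rem n.+1 t i Ki (Bt0 _ tt); rewrite big_ord_recr/=.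
        by apply: le_trans; rewrite le_eqVlt; apply/orP; left; apply/eqP; congr `|_|; ring.
    rewrite lerD2r; apply: (le_trans (distD V0 VD _ _)).
    - exact/bF/Bt0.
    - exact/uboundedZ/bsum.
    rewrite lerD2l (le_trans (distZ V0 VD _ _))// normrN1 mul1r.
    by apply: dsum => k kn; exact: IH.
  have tn : 0 < t ^+ n by rewrite exprn_gt0.
  have h2 : D <= C * B ^+ n.+1 * t.
    have -> : D = d (fun i => t ^- n * (t ^+ n * a n i)).
      rewrite /D; congr d; apply/funext => i.
      by rewrite mulrA mulVf ?mul1r// gt_eqF.
    apply: (le_trans (distZ V0 VD _ _)); first exact: uboundedZ.
    rewrite ger0_norm ?invr_ge0 ?(ltW tn)// ler_pdivrMl// (le_trans h)//.
    by rewrite gtr0_norm// exprMn [t ^+ n.+1]exprSr; lra.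
  have : C * B ^+ n.+1 * t <= D / 2.
    apply: (@le_trans _ _ ((C * B ^+ n.+1 + 1) * (D / (2 * (C * B ^+ n.+1 + 1))))).
      by rewrite ler_pM ?(ltW t_gt0)// ?lerDl// ge_min lexx orbT.
    rewrite le_eqVlt; apply/orP; left; apply/eqP; field.
    by rewrite gt_eqF// ltr_wpDl.
  by lra.
(* The expansion holds for all [B |t| <= 1/2], so this may reach beyond [eta] and to negative
   [t]. *)
move=> t Bt; apply/eqP; rewrite eq_le dist_ge0 andbT.
apply: (le0_geometric C_ge0) => N.
apply: (@le_trans _ _ (d (fun i => \sum_(n < N) t ^+ n * a n i) + C * (B * `|t|) ^+ N)).
  apply: (dist_perturb V0 VD) => //; last by move=> i Ki; exact: Rem.
  by rewrite mulr_ge0// exprn_ge0// mulr_ge0.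
rewrite -[leRHS]add0r lerD//; first exact: dsum.
by rewrite ler_wpM2l// lerXn2r ?nnegrE// mulr_ge0.
Qed.

End MaskedKernel.

(** * Maximum principle and connectedness *)

Section Topology.
Context {R : realType}.
Implicit Types (x y v : point3 R).

Lemma continuous_coord11 : continuous (fun x : point3 R => x.1.1).
Proof. by move=> x; apply: continuous_comp; [exact: cvg_fst|exact: cvg_fst]. Qed.

Lemma continuous_coord12 : continuous (fun x : point3 R => x.1.2).
Proof. by move=> x; apply: continuous_comp; [exact: cvg_fst|exact: cvg_snd]. Qed.

Lemma continuous_coord2 : continuous (fun x : point3 R => x.2).
Proof. by move=> x; exact: cvg_snd. Qed.

Lemma continuous_edot : continuous (fun x : point3 R => edot x x).
Proof.
move=> x; rewrite /edot; apply: cvgD; [apply: cvgD|]; apply: cvgM;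
  by [exact: continuous_coord11|exact: continuous_coord12|exact: continuous_coord2].
Qed.

Lemma continuous_enorm : continuous (@enorm R).
Proof.
move=> x; apply: continuous_comp; first exact: continuous_edot.
exact: sqrt_continuous.
Qed.

Lemma near_enorm x (e : R) : 0 < e -> \forall y \near x, enorm (y - x) < e.
Proof.
move=> e0.
have cB : continuous (fun y : point3 R => enorm (y - x)).
  move=> y; apply: continuous_comp; last exact: continuous_enorm.
  by apply: cvgB; [exact: cvg_id|exact: cvg_cst].
have := cB x; rewrite /continuous_at subrr enorm0.
by move=> /cvgr_lt; exact.
Qed.

Lemma nbhs_enorm x (U : set (point3 R)) : nbhs x U ->
  exists2 e : R, 0 < e & forall y, enorm (y - x) < e -> U y.
Proof.
move=> /nbhs_ballP[e /= e0 eU]; exists e => // y yx; apply: eU.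
have le (a b c : R) : 0 <= a -> 0 <= b -> 0 <= c -> Num.sqrt (a + b + c) < e ->
    [/\ Num.sqrt a < e, Num.sqrt b < e & Num.sqrt c < e].
  move=> a0 b0 c0 h; split; apply: le_lt_trans h; rewrite ler_sqrt ?addr_ge0//; lra.
have [] := le _ _ _ _ _ _ yx; rewrite -?expr2 ?sqr_ge0// !sqrtr_sqr => h1 h2 h3.
by split; [split|]; rewrite /ball /= distrC.
Qed.

Lemma lipschitz_continuous_at (q : point3 R -> R) x (L r : R) : 0 < r ->
  (forall v, enorm v <= r -> `|q (x + v) - q x| <= L * enorm v) ->
  {for x, continuous q}.
Proof.
move=> r0 qL; apply/cvgrPdist_le => e e0.
have L1 : 0 < `|L| + 1 by rewrite ltr_wpDl.
have eL : 0 < e / (`|L| + 1) by rewrite divr_gt0.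
near=> y.
have yr : enorm (y - x) <= r by apply/ltW; near: y; exact: near_enorm.
have yL : enorm (y - x) <= e / (`|L| + 1) by apply/ltW; near: y; exact: near_enorm.
have := qL _ yr; rewrite subrKC distrC => /le_trans; apply.
apply: (@le_trans _ _ ((`|L| + 1) * enorm (y - x))).
  by rewrite ler_wpM2r ?enorm_ge0//; have := ler_norm L; lra.
by rewrite mulrC -ler_pdivlMr.
Unshelve. all: by end_near. Qed.

Lemma compact_annulus (a b : R) : compact [set x : point3 R | a <= enorm x <= b].
Proof.
apply: (@subclosed_compact _ _ (`[-b, b] `*` `[-b, b] `*` `[-b, b])).
- rewrite [X in closed X](_ : _ = (@enorm R) @^-1` `[a, b]).
    by apply: closed_comp => [x _|]; [exact: continuous_enorm|exact: interval_closed].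
  by apply/seteqP; split => x /=; rewrite in_itv.
- by apply: compact_setX; [apply: compact_setX|]; exact: segment_compact.
move=> x /= /andP[_ xb].
have b0 : 0 <= b by exact: le_trans (enorm_ge0 _) xb.
have le (s : R) : s ^+ 2 <= edot x x -> - b <= s <= b.
  move=> sx; rewrite -ler_norml -sqrtr_sqr (le_trans _ xb)//.
  by rewrite ler_wsqrtr.
have := (sqr_ge0 x.1.1, sqr_ge0 x.1.2, sqr_ge0 x.2); rewrite /edot in le *.
move=> [[h1 h2] h3].
by split; [split|]; rewrite /= in_itv/=; apply: le; rewrite -!expr2; lra.
Qed.

Lemma compact_finite_net (S : set (point3 R)) (e : R) : 0 < e -> compact S ->
  exists s : seq (point3 R), (forall x, x \in s -> S x) /\
    forall x, S x -> exists2 y, y \in s & enorm (x - y) < e.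
Proof.
move=> e0 /compact_near_coveringP cS.
(* The filter of properties that hold for every sequence containing some finite part of [S];
   near-covering compactness turns pointwise approximability into one finite net. *)
pose F : set (set (seq (point3 R))) := [set U | exists2 s0 : seq (point3 R),
  (forall x, x \in s0 -> S x) & forall s : seq (point3 R), {subset s0 <= s} -> U s].
have FF : Filter F.
  split.
  - by exists [::].
  - move=> U U' [s sS sU] [s' s'S s'U]; exists (s ++ s').
      by move=> x; rewrite mem_cat => /orP[/sS|/s'S].
    move=> t st; split; [apply: sU|apply: s'U] => x xs;
      by apply: st; rewrite mem_cat xs ?orbT.
  - by move=> U U' UU' [s sS sU]; exists s => // t /sU /UU'.
have [x Sx|s sS sP] := cS _ F (fun s x => exists2 y, y \in s & enorm (x - y) < e) FF.
  exists ([set y | enorm (y - x) < e], [set s : seq (point3 R) | x \in s]) => /=.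
    split; first exact: near_enorm.
    by exists [:: x] => [y|s]; [rewrite inE => /eqP->|apply; rewrite mem_head].
  by move=> [y s] /= [yx xs]; exists x.
by exists s; split => // x Sx; exact: (sP s).
Qed.

Lemma edot_axes x t :
  \sum_(e <- axes) (edot (x + t *: e) (x + t *: e) +
     edot (x + (- t) *: e) (x + (- t) *: e)) = 6 * edot x x + 6 * t ^+ 2.
Proof.
by rewrite !big_cons big_nil /edot /= /GRing.scale /=; ring.
Qed.

(* At a maximum of [q + k |x|^2] the approximate mean value inequality fails at
   order [t^2], so the maximum sits where [q <= eta]. *)
Lemma maximum_principle (B : set (point3 R)) (q : point3 R -> R) (eta M : R) :
  compact B -> (forall x, B x -> {for x, continuous q}) ->
  (forall x, B x -> edot x x <= M) ->
  (forall x, B x -> q x <= eta \/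
     exists C t0 : R, 0 < t0 /\ forall t, 0 < t < t0 ->
       (forall e, e \in axes -> B (x + t *: e) /\ B (x + (- t) *: e)) /\
       6 * q x <= \sum_(e <- axes) (q (x + t *: e) + q (x + (- t) *: e)) + C * t ^+ 4) ->
  forall x, B x -> q x <= eta.
Proof.
move=> cB cq BM qB x Bx.
apply/ler_addgt0Pr => s s0.
have M0 : 0 <= M by exact: le_trans (edot_ge0 x) (BM _ Bx).
have M1 : 0 < M + 1 by rewrite ltr_wpDl.
(* Makes the perturbation [k |x|^2] at most [s] on [B]. *)
pose k := s / (M + 1).
have k0 : 0 < k by rewrite divr_gt0.
have kM : k * M <= s.
  by rewrite /k mulrAC ler_pdivrMr// ler_wpM2l ?(ltW s0)// lerDl.
pose F y := q y + k * edot y y.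
have cF : {within B, continuous F}.
  apply: continuous_in_subspaceT => y /set_mem By.
  apply: cvgD; first exact: cq.
  by apply: cvgM; [exact: cvg_cst|exact: continuous_edot].
have [c /set_mem Bc maxc] := compact_EVT_max (ex_intro _ _ Bx) cB cF.
have maxF y : B y -> F y <= F c by move=> By; apply: maxc; exact/mem_set.
have kpos y : 0 <= k * edot y y by rewrite mulr_ge0 ?edot_ge0 ?ltW.
have kle y : B y -> k * edot y y <= s.
  by move=> By; rewrite (le_trans _ kM)// ler_wpM2l ?BM// ltW.
case: (qB _ Bc) => [qc|[C [t0 [t00 mean]]]].
  have := maxF _ Bx; have := kle _ Bc; have := kpos x; rewrite /F; lra.
have C1 : 0 < `|C| + 1 by rewrite ltr_wpDl.
(* Small enough for [C t^2 <= k], whereas maximality at [c] will give [6 k <= C t^2]. *)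
pose t := Num.min (t0 / 2) (Num.min 1 (k / (`|C| + 1))).
have t_gt0 : 0 < t by rewrite !lt_min ltr01 !divr_gt0.
have tt0 : t < t0.
  by rewrite gt_min ltr_pdivrMr// ltr_pMr// ltr1n.
have t1 : t <= 1 by rewrite !ge_min lexx orbT.
have tk : t * (`|C| + 1) <= k by rewrite -ler_pdivlMr// !ge_min lexx !orbT.
have [Bn] := mean t ltac:(by rewrite t_gt0 tt0).
have : \sum_(e <- axes) (q (c + t *: e) + q (c + (- t) *: e)) <=
    6 * F c - 6 * k * edot c c - 6 * k * t ^+ 2.
  have -> : 6 * F c - 6 * k * edot c c - 6 * k * t ^+ 2 =
    \sum_(e <- axes) (F c + F c - k * (edot (c + t *: e) (c + t *: e) +
     edot (c + (- t) *: e) (c + (- t) *: e))).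
    rewrite big_split/= sumrN -mulr_sumr edot_axes !big_cons big_nil; ring.
  rewrite big_seq [leRHS]big_seq; apply: ler_sum => e /Bn[/maxF h1 /maxF h2].
  by move: h1 h2; rewrite {1 3}/F; lra.
rewrite /F => h1 h2.
have h3 : 6 * k * t ^+ 2 <= C * t ^+ 4 by lra.
have t20 : 0 < t ^+ 2 by rewrite exprn_gt0.
have h4 : 6 * k <= C * t ^+ 2.
  rewrite -(ler_pM2r t20); apply: (le_trans h3).
  by rewrite le_eqVlt; apply/orP; left; apply/eqP; ring.
have h5 : C * t ^+ 2 <= k.
  apply: le_trans tk; rewrite expr2 mulrA [leRHS]mulrC.
  rewrite ler_wpM2r ?(ltW t_gt0)//.
  apply: (@le_trans _ _ (`|C| * t)); first by rewrite ler_wpM2r ?(ltW t_gt0)// ler_norm.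
  by have := ler_wpM2l (normr_ge0 C) t1; lra.
lra.
Qed.

(** The times at which [g] is in [Z] form a relatively open and closed part of [A], and an interval
    is connected. Closedness of [Z] is asked only inside [O], where the path stays. *)
Lemma clopen_path (T : topologicalType) (Z O : set T) (g : R -> T) (A : set R) :
  open Z -> (forall z, O z -> closure Z z -> Z z) -> continuous g ->
  is_interval A -> (forall t, A t -> O (g t)) ->
  forall s t, A s -> A t -> Z (g s) -> Z (g t).
Proof.
move=> oZ cZ cg /connected_intervalP cA AO s t As At Zs.
have E : A `&` g @^-1` Z = A.
  apply: cA; first by exists s.
    exists (g @^-1` Z) => //; apply: open_comp => // x _; exact: cg.
  exists (g @^-1` closure Z).
    by apply: closed_comp => [x _|]; [exact: cg|exact: closed_closure].
  apply/seteqP; split => x [Ax Zx]; split=> //; first exact: subset_closure.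
  by apply: cZ => //; exact: AO.
by move: At; rewrite -{1}E => -[].
Qed.

Lemma continuous_spherical (r : R) : continuous (spherical r).
Proof.
have c1 : continuous (fun p : R * R => sin p.1).
  by move=> p; apply: (@continuous_comp _ _ _ fst sin); [exact: cvg_fst|exact: continuous_sin].
have c2 : continuous (fun p : R * R => cos p.1).
  by move=> p; apply: (@continuous_comp _ _ _ fst cos); [exact: cvg_fst|exact: continuous_cos].
have c3 : continuous (fun p : R * R => sin p.2).
  by move=> p; apply: (@continuous_comp _ _ _ snd sin); [exact: cvg_snd|exact: continuous_sin].
have c4 : continuous (fun p : R * R => cos p.2).
  by move=> p; apply: (@continuous_comp _ _ _ snd cos); [exact: cvg_snd|exact: continuous_cos].
move=> p.
have h1 : (fun p => r * (sin p.1 * cos p.2)) @ p --> r * (sin p.1 * cos p.2).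
  by apply: cvgM; [exact: cvg_cst|apply: cvgM; [exact: c1|exact: c4]].
have h2 : (fun p => r * (sin p.1 * sin p.2)) @ p --> r * (sin p.1 * sin p.2).
  by apply: cvgM; [exact: cvg_cst|apply: cvgM; [exact: c1|exact: c3]].
have h3 : (fun p : R * R => r * cos p.1) @ p --> r * cos p.1.
  by apply: cvgM; [exact: cvg_cst|exact: c2].
exact: (cvg_pair (cvg_pair h1 h2) h3).
Qed.

Lemma enorm_spherical (r : R) p : 0 <= r -> enorm (spherical r p) = r.
Proof.
move=> r0; rewrite /enorm /edot /spherical/=.
rewrite [X in Num.sqrt X](_ : _ = r ^+ 2) ?sqrtr_sqr ?ger0_norm//.
have h1 := cos2Dsin2 p.1; have h2 := cos2Dsin2 p.2.
transitivity (r ^+ 2 * ((sin p.1) ^+ 2 * (cos p.2 ^+ 2 + sin p.2 ^+ 2) + cos p.1 ^+ 2)).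
  by ring.
by rewrite h2 mulr1 addrC h1 mulr1.
Qed.

Lemma circle_param (a b : R) : a ^+ 2 + b ^+ 2 = 1 ->
  exists2 phi, 0 <= phi <= 2 * pi & a = cos phi /\ b = sin phi.
Proof.
move=> ab.
have a1 : -1 <= a <= 1.
  rewrite -ler_norml -(@ler_pXn2r _ 2) ?nnegrE// expr1n real_normK ?num_real//.
  by rewrite -ab lerDl sqr_ge0.
have p0 := acos_ge0 a1; have p1 := acos_lepi a1.
have aI : a \in `[(-1), 1] by rewrite in_itv.
have sE : sin (acos a) = `|b|.
  by rewrite sin_acos// -ab addrAC subrr add0r sqrtr_sqr.
have [b0|b0] := leP 0 b.
  exists (acos a); first by apply/andP; split => //; have := @pi_ge0 R; lra.
  by rewrite acosK// sE ger0_norm.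
exists (2 * pi - acos a); first by apply/andP; split; lra.
have -> : 2 * pi - acos a = - acos a + pi *+ 2 by rewrite mulr2n; ring.
rewrite cosD2pi sinD2pi cosN sinN acosK// sE ler0_norm ?opprK//.
exact: ltW.
Qed.

Lemma sphere_param (r : R) x : 0 < r -> enorm x = r ->
  exists2 p, angles p & x = spherical r p.
Proof.
move=> r0 xr.
have E : x.1.1 ^+ 2 + x.1.2 ^+ 2 + x.2 ^+ 2 = r ^+ 2.
  by rewrite -xr sqr_enorm /edot; ring.
have r1 : r != 0 by rewrite gt_eqF.
pose z := x.2 / r.
have z1 : -1 <= z <= 1.
  rewrite -ler_norml -(@ler_pXn2r _ 2) ?nnegrE// expr1n real_normK ?num_real//.
  rewrite expr_div_n ler_pdivrMr ?exprn_gt0// mul1r -E.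
  by rewrite lerDr addr_ge0 ?sqr_ge0.
have rz : r * z = x.2 by rewrite /z mulrC divfK.
have zI : z \in `[(-1), 1] by rewrite in_itv.
have t0 := acos_ge0 z1; have t1 := acos_lepi z1.
set s := sin (acos z).
have s0 : 0 <= s by rewrite sin_ge0_pi// t0.
have sE : (r * s) ^+ 2 = x.1.1 ^+ 2 + x.1.2 ^+ 2.
  have := cos2Dsin2 (acos z); rewrite acosK// -/s => h.
  have -> : (r * s) ^+ 2 = r ^+ 2 * (z ^+ 2 + s ^+ 2) - (r * z) ^+ 2 by ring.
  by rewrite h rz mulr1 -E; ring.
have xE : x = (x.1.1, x.1.2, x.2) by case: x {xr E z z1 rz zI t0 t1 s s0 sE} => [[]].
have [phi phiI [e1 e2]] : exists2 phi, 0 <= phi <= 2 * pi &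
    x.1.1 = r * (s * cos phi) /\ x.1.2 = r * (s * sin phi).
  (* At the two ends of the polar axis the longitude is arbitrary. *)
  have [rs0|rs0] := eqVneq (r * s) 0.
    move: sE; rewrite rs0 expr0n /= => /esym/eqP.
    rewrite paddr_eq0 ?sqr_ge0// !sqrf_eq0 => /andP[/eqP-> /eqP->].
    exists 0; first by have := @pi_ge0 R; rewrite lexx/=; lra.
    by rewrite !mulrA rs0 !mul0r.
  have [] := @circle_param (x.1.1 / (r * s)) (x.1.2 / (r * s)).
    by rewrite !expr_div_n -mulrDl -sE divff// expf_neq0.
  move=> phi phiI [e1 e2]; exists phi => //.
  by split; rewrite mulrA -?e1 -?e2 [RHS]mulrC divfK.
exists (acos z, phi).
  by split; rewrite /= in_itv/= ?phiI// t0 t1.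
by rewrite /spherical /= -/s -e1 -e2 acosK// rz.
Qed.

End Topology.

(** * The maximum principle on shells, from local mean value inequalities *)

Section LocalMean.
Context {R : realType}.
Implicit Types (x y v : point3 R) (f q : point3 R -> R).

(** What the maximum principle needs at one point. Only a neighbourhood of [x] is involved, so glued
    functions inherit the property. *)
Definition local_mean q x := exists r L C : R, [/\ 0 < r,
  forall v, enorm v <= r -> `|q (x + v) - q x| <= L * enorm v &
  forall t, 0 < t < r ->
    6 * q x <= \sum_(e <- axes) (q (x + t *: e) + q (x + (- t) *: e)) + C * t ^+ 4].

Lemma eq_local_mean f q x (s : R) : 0 < s ->
  (forall v, enorm v <= s -> q (x + v) = f (x + v)) ->
  local_mean f x -> local_mean q x.
Proof.
move=> s0 qf [r [L [C [r0 fL fm]]]].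
have qfx : q x = f x by rewrite -(addr0 x) qf// enorm0 ltW.
exists (Num.min s r), L, C; split; first by rewrite lt_min s0.
  move=> v; rewrite le_min => /andP[vs vr]; rewrite qf// qfx; exact: fL.
move=> t /andP[t0]; rewrite lt_min => /andP[ts tr].
rewrite qfx (le_trans (fm t _)) ?t0// lerD2r le_eqVlt; apply/orP; left; apply/eqP.
rewrite big_seq [RHS]big_seq; apply: eq_bigr => e /axes_enorm e1.
by rewrite !qf// enormZ e1 mulr1 ?normrN gtr0_norm// ltW.
Qed.

(** For [a < 0] the shell is a closed ball and the inner boundary condition is vacuous. *)
Lemma annulus_maximum_principle q (a b eta : R) :
  (forall x, a <= enorm x <= b -> local_mean q x) ->
  (forall x, enorm x = a -> q x <= eta) ->
  (forall x, enorm x = b -> q x <= eta) ->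
  forall x, a <= enorm x <= b -> q x <= eta.
Proof.
move=> qm qa qb.
apply: (@maximum_principle _ _ q eta (b ^+ 2) (@compact_annulus _ a b)).
- move=> x /qm[r [L [C [r0 qL _]]]]; exact: (lipschitz_continuous_at r0 qL).
- move=> x /andP[_ xb]; rewrite -sqr_enorm lerXn2r ?nnegrE ?enorm_ge0//.
  exact: le_trans (enorm_ge0 _) xb.
move=> x axb; have /andP[] := axb; rewrite le_eqVlt => /predU1P[/esym/qa ->|ax]; first by left.
rewrite le_eqVlt => /predU1P[/qb ->|xb]; first by left.
right; have [r [L [C [r0 _ qC]]]] := qm _ axb.
exists C, (Num.min r (Num.min (enorm x - a) (b - enorm x))); split.
  by rewrite !lt_min r0 !subr_gt0 ax.
move=> t /andP[t0]; rewrite !lt_min => /and3P[tr ta tb]; split; last by rewrite qC ?t0.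
have B s e : e \in axes -> `|s| = t -> a <= enorm (x + s *: e) <= b.
  move=> /axes_enorm e1 st.
  have := ler_enormB (x + s *: e) x.
  rewrite addrAC subrr add0r enormZ e1 mulr1 st ler_norml => /andP[h1 h2].
  by apply/andP; split; lra.
by move=> e eA; split; apply: B => //; rewrite ?normrN gtr0_norm.
Qed.

End LocalMean.

(** * Decoupling the outer and the inner poles *)

Section Decoupling.
Context {R : realType}.
Variables (R0 R1 R2 : R) (Gamma : set (point3 R)).
Hypotheses (hR1 : 0 < R1) (hR10 : R1 < R0) (hR02 : R0 < R2).
Hypotheses (Gamma_closed : closed Gamma) (Gamma_sphere : Gamma `<=` sphere R0).
Hypothesis (Gamma_neq : Gamma <> sphere R0).

(* [kern x] on [outer_poles] is the kernel of the adjoint of [Phi0], that is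
   [u . (x - y) / |x - y|^3] with [y] in Gamma and [|u| <= 1].  On [inner_poles]
   it is the Poisson kernel of [Phi1], as
   [|x|^2 - |y|^2 = |x - y|^2 + 2 y . (x - y)]. *)
Definition outer_poles : set (pole_data R) :=
  [set i | [/\ i.1.1 = 0, enorm i.1.2 <= 1 & Gamma i.2]].

Definition inner_poles : set (pole_data R) :=
  [set i | [/\ i.1.1 = 1, i.1.2 = 2 *: i.2 & enorm i.2 = R1]].

Let K := outer_poles `|` inner_poles.

Variable V : set (pole_data R -> R).
Hypothesis V0 : V (fun=> 0).
Hypothesis VD : forall a b f g, V f -> V g -> V (fun i => a * f i + b * g i).
Hypothesis Vsphere : forall x, enorm x = R2 -> dist K V (mkern (fun=> 1) x) = 0.

Definition outer_mask (i : pole_data R) : R := (`[< outer_poles i >])%:R.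
Let c0 := outer_mask.
(** On [K] this is the indicator of the inner poles, as the charges 0 and 1 separate the two
    families. *)
Let c1 i := 1 - c0 i.
Let one (i : pole_data R) : R := 1.
Let D c x := dist K V (mkern c x).

Let K_al i : K i -> `|i.1.1| <= 1.
Proof. by case=> [][-> _ _]; rewrite ?normr0 ?normr1. Qed.

(** Dominates the outer dipoles, of norm at most 1, and the inner ones, of norm [2 * R1]. *)
Let u0 := 1 + 2 * R1.

Let K_u i : K i -> enorm i.1.2 <= u0.
Proof.
case=> [[_ h _]|[_ -> h]]; first by rewrite (le_trans h)// /u0 lerDl mulr_ge0// ltW.
by rewrite enormZ h ger0_norm// /u0 lerDr.
Qed.

Let u00 : 0 <= u0. Proof. by rewrite /u0 addr_ge0// mulr_ge0// ltW. Qed.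

Let c0_le1 i : `|c0 i| <= 1.
Proof. by rewrite /c0 /outer_mask; case: asboolP; rewrite ?normr1 ?normr0. Qed.

Let c1_le1 i : `|c1 i| <= 1.
Proof.
by rewrite /c1 /c0 /outer_mask; case: asboolP; rewrite ?subrr ?subr0 ?normr1 ?normr0.
Qed.

Let one_le1 i : `|one i| <= 1. Proof. by rewrite normr1. Qed.

Let c0_neq0 i : c0 i != 0 -> Gamma i.2.
Proof.
by rewrite /c0 /outer_mask; case: asboolP => [[]//|]; rewrite eqxx.
Qed.

Let c1_neq0 i : K i -> c1 i != 0 -> enorm i.2 = R1.
Proof.
rewrite /c1 /c0 /outer_mask; case: asboolP => [_|h []//]; first by rewrite subrr eqxx.
by case.
Qed.

Let K_le i : K i -> enorm i.2 <= R0.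
Proof. by case=> [[_ _ /Gamma_sphere->]//|[_ _ ->]]; exact: ltW. Qed.

Let dist_ge (x y : point3 R) : enorm x - enorm y <= enorm (x - y).
Proof. by rewrite (le_trans _ (ler_enormB _ _))// ler_norm. Qed.

Let dist_ge' (x y : point3 R) : enorm y - enorm x <= enorm (x - y).
Proof. by rewrite enormB dist_ge. Qed.

Let away_local_mean c x de : (forall i, `|c i| <= 1) -> 0 < de ->
  away K c de x -> local_mean (D c) x.
Proof.
move=> cle de0 ax.
pose C := 13 * (1 / de + u0 / de ^+ 2).
(* The radius [de / 16] makes the ratio [8 |v| / de] at most 1/2. *)
exists (de / 16), (C * (8 / de)), (6 * C * (8 / de) ^+ 4); split.
- by rewrite divr_gt0.
- move=> v vd; have -> : C * (8 / de) * enorm v = C * (8 * (enorm v / de)) by ring.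
  apply: (dist_mkern_lipschitz V0 VD K_al K_u) => //.
  rewrite mulrA ler_pdivrMr//; move: vd; rewrite ler_pdivlMr//; lra.
move=> t /andP[t0 td].
have -> : 6 * C * (8 / de) ^+ 4 * t ^+ 4 = 6 * C * (8 * de^-1 * `|t|) ^+ 4.
  by rewrite gtr0_norm//; ring.
apply: (dist_mkern_mean V0 VD K_al K_u) => //.
by rewrite gtr0_norm// mulrAC ler_pdivrMr//; move: td; rewrite ltr_pdivlMr//; lra.
Qed.

(** On the sphere of radius [R0 + de] all poles are at distance at least [de], and for [de >= 1]
    both terms of the kernel bound are O(1/de). The parameter [x] only pushes this sphere beyond a
    given point. *)
Let decay c (eta x : R) : (forall i, `|c i| <= 1) -> 0 < eta ->
  exists2 b, x <= b & R0 < b /\ forall y, enorm y = b -> D c y <= eta.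
Proof.
move=> cle eta0.
pose de := Num.max 1 (Num.max ((1 + u0) / eta) x).
have de1 : 1 <= de by rewrite le_max lexx.
have de0 : 0 < de by exact: lt_le_trans de1.
exists (R0 + de).
  rewrite (@le_trans _ _ de)// ?lerDr; last by exact/ltW/(lt_trans hR1).
  by rewrite !le_max lexx !orbT.
split; first by rewrite ltrDl.
move=> y yb; apply: (le_trans (dist_mkern_le (al0 := 1) (u0 := u0) (de := de) V0 K_al K_u _ _ cle _ _)) => //.
  move=> i /K_le ile _; rewrite (le_trans _ (dist_ge _ _))// yb; lra.
have e1 : 1 + u0 <= eta * de.
  by rewrite mulrC -ler_pdivrMr// !le_max lexx orbT.
have -> : 1 / de + u0 / de ^+ 2 = (1 + u0 / de) / de by field; rewrite gt_eqF.
rewrite ler_pdivrMr// (le_trans _ e1)// lerD2l ler_piMr//.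
by rewrite invf_le1.
Qed.

Let D_far x : R2 <= enorm x -> D one x = 0.
Proof.
move=> xR2; apply/eqP; rewrite eq_le dist_ge0 andbT.
apply/ler_addgt0Pr => eta eta0; rewrite add0r.
have [b xb [_ bd]] := decay (enorm x) one_le1 eta0.
apply: (@annulus_maximum_principle _ _ R2 b); last by rewrite xR2.
- move=> y /andP[yR2 _]; apply: (@away_local_mean _ _ (R2 - R0)) => //.
    by rewrite subr_gt0.
  by move=> i /K_le ile _; rewrite (le_trans _ (dist_ge _ _))// lerB.
- by move=> y yR2; rewrite /D Vsphere// ltW.
- exact: bd.
Qed.

Let Om : set (point3 R) := [set x | R1 < enorm x /\ ~ Gamma x].
(** The interior of the zero set: continuation along lines needs zeros in every direction to start
    from. *)
Let Z : set (point3 R) :=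
  [set x | exists2 r, 0 < r & forall y, enorm (y - x) < r -> D one y = 0].

Let openZ : open Z.
Proof.
rewrite openE => x [r r0 xr].
have r20 : 0 < r / 2 by rewrite divr_gt0.
have := near_enorm x r20; apply: filterS => y yx; exists (r / 2) => // z zy.
apply: xr; have := enormBD z y x; lra.
Qed.

Let Om_away x : Om x -> exists2 de, 0 < de & away K one de x.
Proof.
move=> [xR1 xG].
have [] := @nbhs_enorm _ x (~` Gamma).
  by apply: open_nbhs_nbhs; split => //; exact: closed_openC.
move=> e e0 eG; exists (Num.min e (enorm x - R1)).
  by rewrite lt_min e0 subr_gt0.
move=> i [[_ _ Gi]|[_ _ i1]] _.
  rewrite ge_min leNgt; apply/orP; left; apply/negP => h.
  by apply: (eG i.2) => //; rewrite enormB.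
by rewrite ge_min -i1 dist_ge orbT.
Qed.

(** The reach of the expansion at a nearby [z] in [Z] depends on the distance to the poles only, not
    on the size of the ball of zeros around [z]; hence it covers a fixed ball around [x]. *)
Let Z_continuation x : Om x -> closure Z x -> Z x.
Proof.
move=> /Om_away[de de0 ax] cx.
have r0 : 0 < de / 64 by rewrite divr_gt0.
exists (de / 64) => // y yx.
have [z [[r rr0 zr] /= zx]] := cx _ (near_enorm x r0).
have az : away K one (de / 2) z.
  move=> i Ki ci; have := ax i Ki ci; have := enormBD x z i.2.
  rewrite (enormB x z); lra.
have yz : enorm (y - z) <= de / 32.
  have := enormBD y x z; rewrite (enormB x z); lra.
have de20 : 0 < de / 2 by rewrite divr_gt0.
have v1 : 0 < enorm (y - z) + 1 by rewrite ltr_wpDl ?enorm_ge0.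
have eta0 : 0 < r / (enorm (y - z) + 1) by rewrite divr_gt0.
have -> : y = z + 1 *: (y - z) by rewrite scale1r subrKC.
apply: (dist_mkern_continuation V0 VD K_al K_u _ _ one_le1 de20 az eta0) => //.
  move=> t /andP[t0 te]; apply: zr; rewrite addrAC subrr add0r enormZ gtr0_norm//.
  move: te; rewrite ltr_pdivlMr//; apply: le_lt_trans.
  by rewrite ler_wpM2l ?(ltW t0)// lerDl.
rewrite normr1 mulr1.
have -> : 8 * (enorm (y - z) / (de / 2)) = 16 * enorm (y - z) / de by field; rewrite gt_eqF.
by rewrite ler_pdivrMr//; lra.
Qed.

Let D_shell x : R1 < enorm x < R0 -> D one x = 0.
Proof.
move=> /andP[xR1 xR0]; have [h0 h1 h2] := And3 hR1 hR10 hR02.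
have R00 : 0 < R0 by exact: lt_trans hR10.
have [p pR0 pG] : exists2 p, sphere R0 p & ~ Gamma p.
  apply: contrapT => h; apply: Gamma_neq; apply/seteqP; split => // p pR0.
  by apply: contrapT => pG; apply: h; exists p.
have [pe _ pE] := sphere_param R00 pR0.
pose r := enorm x; have r0 : 0 < r by exact: lt_trans hR1 xR1.
have [px _ xE] := sphere_param r0 erefl.
have Om_r q : Om (spherical r q).
  split; first by rewrite enorm_spherical// ltW.
  by move=> /Gamma_sphere; rewrite /sphere/= enorm_spherical ?(ltW r0)// => rR0; move: xR0; rewrite -/r rR0 ltxx.
(* Inwards along the ray through a point of the sphere outside Gamma. The start has radius [R2 + 1],
   so that the unit ball around it lies where [D_far] applies. *)
have Z1 : Z (spherical r pe).
  apply: (@clopen_path _ _ Z Om (fun t => spherical t pe) `]R1, +oo[ openZ Z_continuation _ _ _ (R2 + 1) r).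
  - move=> t.
    have h (a : R) : (fun t : R => t * a) @ t --> t * a.
      by apply: cvgM; [exact: cvg_id|exact: cvg_cst].
    exact: (cvg_pair (cvg_pair (h _) (h _)) (h _)).
  - exact: interval_is_interval.
  - move=> t; rewrite /= in_itv/= andbT => tR1.
    have t0 : 0 <= t by exact/ltW/(lt_trans hR1).
    split; first by rewrite enorm_spherical.
    move=> Gt; have := Gamma_sphere Gt; rewrite /sphere/= enorm_spherical// => tE.
    by apply: pG; rewrite pE -tE.
  - by rewrite /= in_itv/= andbT; move: hR10 hR02; lra.
  - by rewrite /= in_itv/= andbT.
  - exists 1 => // y; rewrite enormB => h; apply: D_far.
    have := dist_ge (spherical (R2 + 1) pe) y; rewrite enorm_spherical; lra.
(* On the sphere of radius [r], which misses Gamma, the longitude and then the polar angle are moved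
   to those of [x]. *)
have Z2 : Z (spherical r (pe.1, px.2)).
  apply: (@clopen_path _ _ Z Om (fun t => spherical r (pe.1, t)) setT openZ Z_continuation _ _ _ pe.2 px.2) => //.
  move=> t; apply: (@continuous_comp _ _ _ (fun t => (pe.1, t)) (spherical r)); last exact: continuous_spherical.
    have h (a : R) : (fun=> a) @ t --> a by exact: cvg_cst.
    have hid : (fun t : R => t) @ t --> t by exact: cvg_id.
    exact: (cvg_pair (h _) hid).
have Z3 : Z (spherical r (px.1, px.2)).
  apply: (@clopen_path _ _ Z Om (fun t => spherical r (t, px.2)) setT openZ Z_continuation _ _ _ pe.1 px.1) => //.
  move=> t; apply: (@continuous_comp _ _ _ (fun t => (t, px.2)) (spherical r)); last exact: continuous_spherical.
  have h (a : R) : (fun=> a) @ t --> a by exact: cvg_cst.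
  have hid : (fun t : R => t) @ t --> t by exact: cvg_id.
  exact: (cvg_pair hid (h _)).
move: Z3; rewrite -surjective_pairing -xE => -[s s0]; apply.
by rewrite subrr enorm0.
Qed.

(** Used with [a = -1] for [c0 = 1 - c1] and for [c1 = 1 - c0]: where W0 + W1 is at distance 0, W0
    and W1 have equal distances. *)
Let D_triangle x (c c' : pole_data R -> R) (a : R) : Om x ->
  (forall i, `|c i| <= 1) -> (forall i, `|c' i| <= 1) -> `|a| <= 1 ->
  (forall i, c i = 1 + a * c' i) -> D c x <= D one x + D c' x.
Proof.
move=> /Om_away[de de0 ax] cle c'le a1 cE.
have aw e : away K e de x by move=> i Ki _; apply: ax; rewrite ?oner_eq0.
have bdd e : (forall i, `|e i| <= 1) -> ubounded K (mkern e x).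
  by move=> ele; exact: (ubounded_mkern (al0 := 1) K_al K_u _ _ ele de0 (aw e)).
rewrite /D [mkern c x](_ : _ = fun i => mkern one x i + a * mkern c' x i).
  apply: (le_trans (distD V0 VD _ _)); [exact: bdd|exact/uboundedZ/bdd|].
  rewrite lerD2l (le_trans (distZ V0 VD _ _))//; first exact: bdd.
  by rewrite ler_piMl// dist_ge0.
by apply/funext => i; rewrite /mkern cE /one; ring.
Qed.

Lemma dist_outer_kern x : enorm x = R2 -> dist K V (mkern outer_mask x) = 0.
Proof.
move=> xR2; have [h0 h1 h2] := And3 hR1 hR10 hR02.
have Om_x y : R1 < enorm y -> enorm y != R0 -> Om y.
  by move=> yR1 yR0; split => // /Gamma_sphere yE; move: yR0; rewrite yE eqxx.
pose r := (R1 + R0) / 2.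
have [r1 r2] : R1 < r /\ r < R0 by rewrite /r; split; lra.
(* [q] equals [D c0] wherever [|y| < R0] and [D c1] wherever [|y| > R1]. These open sets cover the
   space, so near every point [q] is the distance of a kernel that is regular there. *)
pose q y := if enorm y <= r then D c0 y else D c1 y.
have D01 z : Om z -> D one z = 0 -> D c0 z = D c1 z.
  move=> Oy Dy; apply/eqP; rewrite eq_le; apply/andP; split.
    rewrite -[leRHS]add0r -{1}Dy; apply: (@D_triangle _ _ _ (-1)) => //.
      by rewrite normrN1.
    by move=> i; rewrite /c1; ring.
  rewrite -[leRHS]add0r -{1}Dy; apply: (@D_triangle _ _ _ (-1)) => //.
    by rewrite normrN1.
  by move=> i; rewrite /c1; ring.
have q0 y : enorm y < R0 -> q y = D c0 y.
  rewrite /q => yR0; case: leP => // yr.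
  have yR1 : R1 < enorm y by exact: lt_trans yr.
  rewrite D01 ?D_shell ?yR1//; apply: Om_x => //.
  by rewrite lt_eqF.
have q1 y : R1 < enorm y -> q y = D c1 y.
  rewrite /q => yR1; case: leP => // yr.
  have yR0 : enorm y < R0 by exact: le_lt_trans r2.
  rewrite D01 ?D_shell ?yR1//; apply: Om_x => //.
  by rewrite lt_eqF.
have q_le eta : 0 < eta -> D c1 x <= eta.
  move=> eta0; have [b xb [bR0 bd]] := decay (enorm x) c1_le1 eta0.
  rewrite -q1; last by rewrite xR2; lra.
  (* The lower radius -1 gives a full ball, with no inner boundary. *)
  apply: (@annulus_maximum_principle _ q (-1) b).
  - move=> y _; have [yR0|yR0] := ltP (enorm y) R0.
      have s0 : 0 < (R0 - enorm y) / 2 by rewrite divr_gt0// subr_gt0.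
      apply: (eq_local_mean s0 (f := D c0)).
        move=> v vs; apply: q0; have := enormD y v; lra.
      apply: (@away_local_mean _ _ (R0 - enorm y)) => //.
        by rewrite subr_gt0.
      by move=> i _ /c0_neq0/Gamma_sphere h; rewrite -{1}h dist_ge'.
    have s0 : 0 < (enorm y - R1) / 2 by rewrite divr_gt0// subr_gt0; lra.
    apply: (eq_local_mean s0 (f := D c1)).
      move=> v vs; apply: q1; have := dist_ge y (- v); rewrite opprK enormN; lra.
    apply: (@away_local_mean _ _ (enorm y - R1)) => //.
      by rewrite subr_gt0; lra.
    by move=> i Ki /(c1_neq0 Ki) h; rewrite -{1}h dist_ge.
  - by move=> y y1; have := enorm_ge0 y; rewrite y1; lra.
  - by move=> y yb; rewrite q1 ?bd// yb; lra.
  - by rewrite xb andbT; have := enorm_ge0 x; lra.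
have Dc1 : D c1 x = 0.
  apply/eqP; rewrite eq_le dist_ge0 andbT; apply/ler_addgt0Pr => eta eta0.
  by rewrite add0r q_le.
rewrite -/(D c0 x) D01 ?D_far ?xR2//; apply: Om_x; rewrite xR2; first by lra.
by rewrite gt_eqF.
Qed.

End Decoupling.

(** * Integrals over spheres *)

Section BilinearIntegral.
Context d1 d2 (T1 : measurableType d1) (T2 : measurableType d2) (R : realType).
Variables (mu : {sigma_finite_measure set T1 -> \bar R})
          (nu : {sigma_finite_measure set T2 -> \bar R}).

Lemma integrable_mul_bounded d (T : measurableType d) (m : {measure set T -> \bar R})
    (D : set T) (f k : T -> R) (M : R) : measurable D ->
  m.-integrable D (EFin \o f) -> measurable_fun D k -> (forall x, D x -> `|k x| <= M) ->
  m.-integrable D (EFin \o (fun x => f x * k x)).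
Proof.
move=> mD fi mk kM; apply: (@integrableMl _ _ _ m D mD (EFin \o f) k) => //.
exists M; split; first exact: num_real.
by move=> N MN x Dx /=; rewrite (le_trans (kM _ Dx))// ltW.
Qed.

Variables (f : T1 -> R) (h : T2 -> R) (k : T1 * T2 -> R) (M : R).
Hypothesis fi : mu.-integrable setT (EFin \o f).
Hypothesis hi : nu.-integrable setT (EFin \o h).
Hypothesis mk : measurable_fun setT k.
Hypothesis kM : forall z, `|k z| <= M.

Let mf : measurable_fun setT f.
Proof. by apply/measurable_EFinP; exact: measurable_int fi. Qed.

Let mh : measurable_fun setT h.
Proof. by apply/measurable_EFinP; exact: measurable_int hi. Qed.

Let F z := (f z.1 * h z.2) * k z.

(** Tonelli for the product of [f] and [h], then boundedness of [k]. *)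
Let integrable_F : (mu \x nu)%E.-integrable setT (EFin \o F).
Proof.
apply: (@integrable_mul_bounded _ _ _ _ (fun z : T1 * T2 => f z.1 * h z.2) k M) => //.
apply/integrable12ltyP.
  apply/measurable_EFinP; apply: measurable_funM; exact: measurableT_comp.
under eq_integral => x _.
  under eq_integral => y _ do rewrite /= normrM EFinM.
  rewrite ge0_integralZl//; last first.
    by apply/measurable_EFinP; exact: measurableT_comp.
  over.
have /integrableP[_ fy] := fi; have /integrableP[_ hy] := hi.
have hfin : (\int[nu]_y `|(EFin \o h) y| \is a fin_num)%E.
  by rewrite ge0_fin_numE ?integral_ge0.
have -> : (\int[mu]_x (`|f x|%:E * \int[nu]_x0 `|h x0|%:E) =
    \int[mu]_x `|(EFin \o f) x| * \int[nu]_y `|(EFin \o h) y|)%E.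
  rewrite -(fineK hfin) ge0_integralZr//.
  - by apply/measurable_EFinP; exact: measurableT_comp.
  - by rewrite lee_fin fine_ge0// integral_ge0.
have ffin : (\int[mu]_x `|(EFin \o f) x| \is a fin_num)%E.
  by rewrite ge0_fin_numE ?integral_ge0.
by rewrite -(fineK hfin) -(fineK ffin) -EFinM ltry.
Qed.

Let hk_integrable x : nu.-integrable setT (EFin \o (fun y => h y * k (x, y))).
Proof.
apply: (@integrable_mul_bounded _ _ _ _ _ _ M) => //.
by apply: measurableT_comp => //; exact: measurable_pair1.
Qed.

Let fk_integrable y : mu.-integrable setT (EFin \o (fun x => f x * k (x, y))).
Proof.
apply: (@integrable_mul_bounded _ _ _ _ _ _ M) => //.
by apply: measurableT_comp => //; exact: measurable_pair2.
Qed.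

Let innerE x : (f x * \int[nu]_y (h y * k (x, y)))%:E = (\int[nu]_y (EFin \o F) (x, y))%E.
Proof.
rewrite EFinM fineK; last by apply: integrable_fin_num => //; exact: hk_integrable.
rewrite -integralZl//; last exact: hk_integrable.
apply: eq_integral => y _.
by rewrite /F /= -EFinM mulrA.
Qed.

Let outerE y : (h y * \int[mu]_x (f x * k (x, y)))%:E = (\int[mu]_x (EFin \o F) (x, y))%E.
Proof.
rewrite EFinM fineK; last by apply: integrable_fin_num => //; exact: fk_integrable.
rewrite -integralZl//; last exact: fk_integrable.
apply: eq_integral => x _.
by rewrite /F /= -EFinM mulrCA mulrA.
Qed.

Lemma integrable_bilinear :
  mu.-integrable setT (EFin \o (fun x => f x * \int[nu]_y (h y * k (x, y)))).
Proof.
have := integrable_fubini_F integrable_F; apply: eq_integrable => // x _.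
by rewrite /= innerE.
Qed.

Lemma Rintegral_bilinear :
  \int[mu]_x (f x * \int[nu]_y (h y * k (x, y))) =
  \int[nu]_y (h y * \int[mu]_x (f x * k (x, y))).
Proof.
rewrite /Rintegral; congr fine.
under eq_integral do rewrite innerE.
under [RHS]eq_integral do rewrite outerE.
exact: (Fubini integrable_F).
Qed.

End BilinearIntegral.

(** The bound is asked only where [h] does not vanish, because approximation is known at admissible
    poles only. *)
Lemma Rintegral_bilinear_le d1 d2 (T1 : measurableType d1) (T2 : measurableType d2)
    (R : realType) (mu : {sigma_finite_measure set T1 -> \bar R})
    (nu : {sigma_finite_measure set T2 -> \bar R})
    (f : T1 -> R) (h : T2 -> R) (k : T1 * T2 -> R) (M e : R) :
  mu.-integrable setT (EFin \o f) -> nu.-integrable setT (EFin \o h) ->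
  measurable_fun setT k -> (forall z, `|k z| <= M) ->
  (forall y, h y != 0 -> `|\int[mu]_x (f x * k (x, y))| <= e) ->
  `|\int[mu]_x (f x * \int[nu]_y (h y * k (x, y)))| <= e * \int[nu]_y `|h y|.
Proof.
move=> fi hi mk kM he; rewrite (Rintegral_bilinear fi hi mk kM).
have mk' : measurable_fun setT (fun z : T2 * T1 => k (z.2, z.1)).
  by apply: (measurableT_comp mk); exact: measurable_fun_pair.
have Gi := integrable_bilinear hi fi mk' (fun z => kM (z.2, z.1)).
rewrite (le_trans (le_normr_Rintegral _ Gi))//.
rewrite -RintegralZl//; last exact: integrable_norm.
apply: le_Rintegral => //.
- exact: integrable_norm.
- have := integrableZl measurableT e (integrable_norm hi).
  by apply: eq_integrable.
move=> y _; rewrite normrM mulrC.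
have [->|hy] := eqVneq (h y) 0; first by rewrite normr0 !mulr0.
by rewrite ler_wpM2r// he.
Qed.

(** * Surface measure: finiteness, measurability, positive mass of caps *)

Section SurfaceMeasureTheory.
Context {R : realType}.
Local Notation leb := (@lebesgue_measure R).
Implicit Types (x y : point3 R) (r : R).

Lemma measurable_spherical r : measurable_fun setT (@spherical R r).
Proof.
have msin : measurable_fun [set: R] (@sin R).
  by apply: continuous_measurable_fun; exact: continuous_sin.
have mcos : measurable_fun [set: R] (@cos R).
  by apply: continuous_measurable_fun; exact: continuous_cos.
apply: measurable_fun_pair; [apply: measurable_fun_pair|];
  apply: measurable_funM => //; try apply: measurable_funM;
  by [exact: measurableT_comp msin _ | exact: measurableT_comp mcos _].
Qed.

Lemma measurable_angles : measurable (@angles R).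
Proof. by apply: measurableX; exact: measurable_itv. Qed.

Lemma measurable_sin_fst r (D : set (R * R)) :
  measurable_fun D (fun p : R * R => (r ^+ 2 * sin p.1)%:E).
Proof.
apply: measurable_funTS; apply/measurable_EFinP.
apply: measurable_funM => //; apply: measurableT_comp => //.
by apply: continuous_measurable_fun; exact: continuous_sin.
Qed.

Lemma lebesgue2_setX (A B : set R) : measurable A -> measurable B ->
  (leb \x leb)%E (A `*` B) = (leb A * leb B)%E.
Proof. by move=> mA mB; exact: product_measure1E. Qed.

Lemma surface_setT_lty r : (surface r setT < +oo)%E.
Proof.
rewrite /surface preimage_setT setIT.
apply: (@le_lt_trans _ _ (\int[(leb \x leb)%E]_(p in angles) (r ^+ 2)%:E)%E).
  apply: ge0_le_integral => //.
  - exact: measurable_angles.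
  - case=> a b [/= + _]; rewrite in_itv/= => ab.
    by rewrite lee_fin mulr_ge0 ?sqr_ge0 ?sin_ge0_pi.
  - exact: measurable_sin_fst.
  - by move=> p _; rewrite lee_fin ler_piMr ?sqr_ge0 ?sin_le1.
rewrite integral_cst; last exact: measurable_angles.
rewrite [X in (_ * X)%E]lebesgue2_setX; try exact: measurable_itv.
by rewrite !lebesgue_measure_itv /= !lte_fin; do 2 case: ifP => _;
  rewrite ?mul0e ?mule0 ?ltry// -EFinB -?EFinM ltry.
Qed.

Let surface_fin r : fin_num_fun (surface r : set (point3 R) -> \bar R).
Proof.
move=> A mA; rewrite ge0_fin_numE ?measure_ge0//.
by rewrite (le_lt_trans _ (surface_setT_lty r))// le_measure ?inE.
Qed.

HB.instance Definition _ r :=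
  @Measure_isFinite.Build _ _ _ (surface r) (surface_fin r).

Lemma measurable_edot (d : _) (T : measurableType d) (f g : T -> point3 R) :
  measurable_fun setT f -> measurable_fun setT g ->
  measurable_fun setT (fun t => edot (f t) (g t)).
Proof.
move=> mf mg.
have m1 (k : T -> point3 R) : measurable_fun setT k -> measurable_fun setT (fun t => (k t).1).
  by move=> mk; apply: measurableT_comp.
have m2 (k : T -> point3 R) : measurable_fun setT k -> measurable_fun setT (fun t => (k t).2).
  by move=> mk; apply: measurableT_comp.
by rewrite /edot; apply: measurable_funD; [apply: measurable_funD|];
  apply: measurable_funM; try (exact: m2); apply: measurableT_comp => //; exact: m1.
Qed.

Lemma measurable_enorm (d : _) (T : measurableType d) (f : T -> point3 R) :
  measurable_fun setT f -> measurable_fun setT (fun t => enorm (f t)).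
Proof.
move=> mf; rewrite /enorm; apply: (@measurableT_comp _ _ _ _ _ _ (@Num.sqrt R)).
  by apply: continuous_measurable_fun; exact: sqrt_continuous.
exact: measurable_edot.
Qed.

Lemma measurable_inv : measurable_fun setT (@GRing.inv R).
Proof.
have -> : setT = [set 0 : R] `|` ~` [set 0] by rewrite setUv.
apply/measurable_funU => //; first exact: measurableC.
split; first exact: measurable_fun_set1.
apply: open_continuous_measurable_fun.
  by apply: closed_openC; exact: closed_eq.
by move=> x; rewrite inE => /eqP x0; exact: inv_continuous.
Qed.

Lemma measurable_pole (d : _) (T : measurableType d) (al : R) (f g : T -> point3 R) :
  measurable_fun setT f -> measurable_fun setT g ->
  measurable_fun setT (fun t => pole al (f t) (g t)).
Proof.
move=> mf mg; have mn := measurable_enorm mg.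
rewrite /pole; apply: measurable_funM.
  apply: measurable_funD; last exact: measurable_edot.
  by apply: measurable_funM => //; apply: measurable_funX.
apply: (measurableT_comp measurable_inv).
by apply: measurable_funX.
Qed.

Lemma measurable_subp (d : _) (T : measurableType d) (f g : T -> point3 R) :
  measurable_fun setT f -> measurable_fun setT g ->
  measurable_fun setT (fun t => f t - g t).
Proof.
move=> mf mg.
have m1 (k : T -> point3 R) : measurable_fun setT k -> measurable_fun setT (fun t => (k t).1).
  by move=> mk; apply: measurableT_comp.
have m2 (k : T -> point3 R) : measurable_fun setT k -> measurable_fun setT (fun t => (k t).2).
  by move=> mk; apply: measurableT_comp.
apply: measurable_fun_pair; first apply: measurable_fun_pair.
- by apply: measurable_funB; apply: measurableT_comp => //; exact: m1.
- by apply: measurable_funB; apply: measurableT_comp => //; exact: m1.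
- by apply: measurable_funB; exact: m2.
Qed.

Lemma measurable_sphere r : measurable (@sphere R r).
Proof.
have m : measurable_fun setT (fun y : point3 R => enorm y).
  by apply: measurable_enorm; exact: measurable_id.
by have := m measurableT [set r] (measurable_set1 r); rewrite setTI.
Qed.

Definition cap r x (e : R) : set (point3 R) :=
  sphere r `&` [set y | enorm (y - x) < e].

Lemma measurable_cap r x e : measurable (cap r x e).
Proof.
apply: measurableI; first exact: measurable_sphere.
have m : measurable_fun setT (fun y : point3 R => enorm (y - x)).
  by apply: measurable_enorm; exact: measurable_subp.
have := m measurableT `]-oo, e[%classic (measurable_itv _).
rewrite setTI; congr measurable; apply/seteqP; split => y /=; rewrite in_itv//.
Qed.

(** The cap contains the image of a rectangle of angles on which the sine has a positive minimum. *)
Lemma surface_cap_gt0 r x e : 0 < r -> sphere r x -> 0 < e ->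
  (0 < surface r (cap r x e))%E.
Proof.
move=> r0 xr e0; have [p [p1 p2] xE] := sphere_param r0 xr.
have [s s0 sP] : exists2 s : R, 0 < s & forall q : R * R,
    `|p.1 - q.1| < s -> `|p.2 - q.2| < s -> enorm (spherical r q - x) < e.
  have : \forall q \near p, enorm (spherical r q - x) < e.
    have := near_enorm x e0; rewrite {1}xE => /(continuous_spherical (r := r)) .
    by rewrite nbhs_filterE.
  move=> /nbhs_ballP[s /= s0 sP]; exists s => // q h1 h2; apply: sP.
  by split.
move: p1 p2; rewrite /= !in_itv/= => /andP[p10 p1pi] /andP[p20 p2pi].
have pi0 := @pi_gt0 R.
pose a := Num.max (p.1 - s / 2) 0; pose b := Num.min (p.1 + s / 2) pi.
(* The middle third of [[a, b]] stays away from 0 and pi, where the area element vanishes; [x]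
   itself may lie on the polar axis. *)
pose a' := (2 * a + b) / 3; pose b' := (a + 2 * b) / 3.
pose c := Num.max (p.2 - s / 2) 0; pose d := Num.min (p.2 + s / 2) (2 * pi).
have ab : a < b by rewrite lt_min !gt_max; apply/andP; split; apply/andP; split; lra.
have cd : c < d by rewrite lt_min !gt_max; apply/andP; split; apply/andP; split; lra.
have a0 : 0 <= a by rewrite le_max lexx orbT.
have ap : p.1 - s / 2 <= a by rewrite le_max lexx.
have bpi : b <= pi by rewrite ge_min lexx orbT.
have bp : b <= p.1 + s / 2 by rewrite ge_min lexx.
have c0 : 0 <= c by rewrite le_max lexx orbT.
have cp : p.2 - s / 2 <= c by rewrite le_max lexx.
have dpi : d <= 2 * pi by rewrite ge_min lexx orbT.
have dp : d <= p.2 + s / 2 by rewrite ge_min lexx.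
have a'b' : a' < b' by rewrite /a' /b'; lra.
have [t tI tmin] := EVT_min (ltW a'b') (continuous_subspaceT (@continuous_sin R)).
have st : 0 < sin t.
  move: tI; rewrite in_itv/= => /andP[t1 t2]; apply: sin_gt0_pi.
  by move: t1 t2; rewrite /a' /b' => t1 t2; apply/andP; split; lra.
pose Q : set (R * R) := `[a', b'] `*` `[c, d].
have mQ : measurable Q by apply: measurableX; exact: measurable_itv.
have QA : Q `<=` angles `&` spherical r @^-1` cap r x e.
  move=> [q1 q2] [/=]; rewrite !in_itv/= /a' /b' => /andP[h1 h2] /andP[h3 h4].
  split; first by split; rewrite /= in_itv/=; apply/andP; split; lra.
  split; first by rewrite /sphere/= enorm_spherical// ltW.
  by apply: sP => /=; rewrite ltr_norml; apply/andP; split; lra.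
apply: (@lt_le_trans _ _ (\int[(leb \x leb)%E]_(q in Q) (r ^+ 2 * sin t)%:E)%E).
  rewrite integral_cst//.
  rewrite [X in (_ * X)%E]lebesgue2_setX; try exact: measurable_itv.
  rewrite !lebesgue_measure_itv/= !lte_fin a'b' cd.
  by rewrite -!EFinB -!EFinM lte_fin !mulr_gt0 ?exprn_gt0 ?subr_gt0.
apply: (@le_trans _ _ (\int[(leb \x leb)%E]_(q in Q) (r ^+ 2 * sin q.1)%:E)%E).
  apply: ge0_le_integral => //.
  - by move=> q _; rewrite lee_fin mulr_ge0 ?sqr_ge0 ?(ltW st).
  - exact: measurable_sin_fst.
  - by move=> q [q1 _]; rewrite lee_fin ler_wpM2l ?sqr_ge0// tmin.
apply: ge0_subset_integral => //.
- apply: measurableI; first exact: measurable_angles.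
  by rewrite -[_ @^-1` _]setTI; apply: measurable_spherical => //; exact: measurable_cap.
- exact: measurable_sin_fst.
- move=> q [[/= + _] _]; rewrite in_itv/= => q1.
  by rewrite lee_fin mulr_ge0 ?sqr_ge0 ?sin_ge0_pi.
Qed.

End SurfaceMeasureTheory.

(** * Uniform approximation of outer potentials by bounded densities *)

Section Approximation.
Context {R : realType}.
Variables (R0 R1 R2 : R) (Gamma : set (point3 R)).
Hypotheses (hR1 : 0 < R1) (hR10 : R1 < R0) (hR02 : R0 < R2).
Hypotheses (Gamma_closed : closed Gamma) (Gamma_sphere : Gamma `<=` sphere R0).
Hypothesis (Gamma_neq : Gamma <> sphere R0).

Let K := outer_poles Gamma `|` inner_poles R1.
Local Notation S := (@sphere R R2).
Local Notation mu := (@surface R R2).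
Let de := R2 - R0.

(* All that the size estimates retain of outer and inner poles. *)
Definition near_poles : set (pole_data R) :=
  [set i | [/\ `|i.1.1| <= 1, enorm i.1.2 <= 1 + 2 * R1 & enorm i.2 <= R0]].

Let de0 : 0 < de. Proof. by rewrite subr_gt0. Qed.

Lemma near_polesP i : K i -> near_poles i.
Proof.
have h1 := hR1; have h2 := hR10.
case=> [] [e1 e2 e3]; split; rewrite ?e1 ?normr0 ?normr1//.
- by rewrite (le_trans e2)// lerDl mulr_ge0// ltW.
- by rewrite (Gamma_sphere e3).
- by rewrite e2 enormZ e3 ger0_norm// lerDr.
- by rewrite e3 ltW.
Qed.

Definition kern_bound := 1 / (R2 - R0) + (1 + 2 * R1) / (R2 - R0) ^+ 2.

Lemma near_poles_dist i x : near_poles i -> S x -> de <= enorm (x - i.2).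
Proof.
move=> [_ _ i2] xS; have := ler_enormB x i.2; rewrite xS => /(le_trans (ler_norm _)).
by apply: le_trans; rewrite lerD2l lerN2.
Qed.

Lemma kern_le i x : near_poles i -> S x -> `|kern x i| <= kern_bound.
Proof.
move=> Ki xS; have dx := near_poles_dist Ki xS; case: Ki => i1 i2 _.
have w0 := lt_le_trans de0 dx.
rewrite (le_trans (pole_bound i1 i2 w0))//.
have u00 : 0 <= 1 + 2 * R1 by rewrite addr_ge0// mulr_ge0// ltW.
by rewrite lerD// ler_wpM2l// lef_pV2 ?posrE ?exprn_gt0// lerXn2r ?nnegrE// ltW.
Qed.

Lemma kern_bound_ge0 : 0 <= kern_bound.
Proof.
have u00 : 0 <= 1 + 2 * R1 by rewrite addr_ge0// mulr_ge0// ltW.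
by rewrite addr_ge0 ?divr_ge0 ?exprn_ge0// ltW.
Qed.

Let L := 13 * kern_bound * (8 / de).

Let L_ge0 : 0 <= L.
Proof. by rewrite mulr_ge0 ?(mulr_ge0 _ kern_bound_ge0)// divr_ge0// ltW. Qed.

Lemma kern_lipschitz i x x0 rho : near_poles i -> S x0 -> enorm (x - x0) <= rho ->
  rho <= de / 16 -> `|kern x i - kern x0 i| <= L * rho.
Proof.
move=> Ki xS xrho rhode; have dx := near_poles_dist Ki xS; case: Ki => i1 i2 _.
have := @pole_lipschitz _ _ _ _ _ _ (x0 - i.2) (x - x0) de0 i1 i2 dx.
rewrite addrAC subrKC => h; apply: (le_trans (h _)).
  rewrite mulrA ler_pdivrMr//; move: (le_trans xrho rhode); rewrite ler_pdivlMr//; lra.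
have -> : 13 * (1 / de + (1 + 2 * R1) / de ^+ 2) * (8 * (enorm (x - x0) / de)) =
  L * enorm (x - x0) by rewrite /L /kern_bound; ring.
by rewrite ler_wpM2l.
Qed.

Lemma measurable_kern (i : pole_data R) (D : set (point3 R)) :
  measurable_fun D (fun x => kern x i).
Proof.
by apply: measurable_funTS; apply: measurable_pole => //; exact: measurable_subp.
Qed.

Lemma integrable_kern i A (g : point3 R -> R) : near_poles i -> measurable A -> A `<=` S ->
  mu.-integrable A (EFin \o g) -> mu.-integrable A (EFin \o (fun x => g x * kern x i)).
Proof.
move=> Ki mA AS gi; apply: (integrable_mul_bounded (M := kern_bound)) => //.
  exact: measurable_kern.
by move=> x /AS; exact: kern_le.
Qed.

Let integrable_cst A r : measurable A -> mu.-integrable A (EFin \o (fun=> r)).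
Proof. by move=> mA; exact: finite_measure_integrable_cst. Qed.

(** On a small piece, a density acts like its total mass placed at [x0]. This serves both
    directions: a constant density reaches a single kernel, and the potential of [g] reduces to
    multiples of kernels. *)
Lemma cap_approx A x0 rho (g : point3 R -> R) i : near_poles i ->
  measurable A -> A `<=` S -> S x0 -> (forall x, A x -> enorm (x - x0) <= rho) ->
  rho <= de / 16 -> mu.-integrable A (EFin \o g) ->
  `|\int[mu]_(x in A) (g x * kern x i) - (\int[mu]_(x in A) g x) * kern x0 i| <=
  L * rho * \int[mu]_(x in A) `|g x|.
Proof.
move=> Ki mA AS x0S Arho rhode gi.
have gk := integrable_kern Ki mA AS gi.
have gi' : mu.-integrable A (EFin \o (fun x => g x * kern x0 i)).
  by have := integrableZr mA (kern x0 i) gi.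
rewrite -RintegralZr// -RintegralB//.
have di : mu.-integrable A (EFin \o (fun x => g x * kern x i - g x * kern x0 i)).
  by have := integrableB mA gk gi'.
rewrite (le_trans (le_normr_Rintegral _ di))//.
rewrite -RintegralZl//; last exact: integrable_norm.
apply: le_Rintegral => //.
- exact: integrable_norm.
- by have := integrableZl mA (L * rho) (integrable_norm gi).
move=> x Ax; rewrite -mulrBr normrM mulrC ler_wpM2r//.
by apply: kern_lipschitz => //; exact: Arho.
Qed.

(** Cut off outside [K] so that linearity in [f] is an identity of functions on all pole data; on
    [K] the integrals converge. *)
Definition potential (f : point3 R -> R) (i : pole_data R) : R :=
  (`[< K i >])%:R * \int[mu]_(x in S) (f x * kern x i).

Definition bounded_potentials : set (pole_data R -> R) :=
  [set F | exists f : point3 R -> R,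
    [/\ measurable_fun setT f, exists M : R, forall x, `|f x| <= M
                      & F = potential f]].

Let V := bounded_potentials.

Let mS : measurable S. Proof. exact: measurable_sphere. Qed.

Lemma integrable_bounded A (f : point3 R -> R) M : measurable A ->
  measurable_fun setT f -> (forall x, `|f x| <= M) -> mu.-integrable A (EFin \o f).
Proof.
move=> mA mf fM; apply: measurable_bounded_integrable => //.
- by rewrite (le_lt_trans _ (surface_setT_lty R2))// le_measure ?inE.
- exact: measurable_funTS.
- exists M; split; first exact: num_real.
  by move=> N MN x Ax /=; rewrite (le_trans (fM _))// ltW.
Qed.

Let V0 : V (fun=> 0).
Proof.
exists (fun=> 0); split => //; first by exists 0 => x; rewrite normr0.
apply/funext => i; rewrite /potential.
under eq_Rintegral do rewrite mul0r.
by rewrite Rintegral_cst// mul0r mulr0.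
Qed.

Let VD a b F G : V F -> V G -> V (fun i => a * F i + b * G i).
Proof.
move=> [f [mf [M fM] ->]] [g [mg [N gN] ->]].
exists (fun x => a * f x + b * g x); split.
- by apply: measurable_funD; apply: measurable_funM.
- exists (`|a| * M + `|b| * N) => x; rewrite (le_trans (ler_normD _ _))// !normrM.
  by rewrite lerD// ler_wpM2l.
apply/funext => i; rewrite /potential; case: asboolP => Ki; last by rewrite !mul0r !mulr0 addr0.
have Ni := near_polesP Ki.
have fi := integrable_kern Ni mS (@subset_refl _ _) (integrable_bounded mS mf fM).
have gi := integrable_kern Ni mS (@subset_refl _ _) (integrable_bounded mS mg gN).
rewrite !mul1r -!RintegralZl// -RintegralD//.
- by apply: eq_Rintegral => x _; ring.
- by have := integrableZl mS a fi.
- by have := integrableZl mS b gi.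
Qed.

Let Vsphere x0 : enorm x0 = R2 -> dist K V (mkern (fun=> 1) x0) = 0.
Proof.
move=> x0S; apply/eqP; rewrite eq_le dist_ge0 andbT.
apply/ler_addgt0Pr => eta eta0; rewrite add0r.
have L1 : 0 < L + 1 by rewrite ltr_wpDl.
pose rho := Num.min (de / 16) (eta / (L + 1)).
have rho0 : 0 < rho by rewrite lt_min !divr_gt0.
have rhode : rho <= de / 16 by rewrite ge_min lexx.
have Lrho : L * rho <= eta.
  apply: (@le_trans _ _ ((L + 1) * (eta / (L + 1)))).
    by rewrite ler_pM ?lerDl ?(ltW rho0)// ge_min lexx orbT.
  by rewrite mulrC divfK// gt_eqF.
pose A := cap R2 x0 rho.
have mA : measurable A by exact: measurable_cap.
have AS : A `<=` S by move=> x [].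
have R20 : 0 < R2 by exact/(lt_trans hR1)/(lt_trans hR10).
have A0 : (0 < mu A)%E by exact: surface_cap_gt0.
have Afin : mu A \is a fin_num by rewrite fin_num_measure.
pose c := fine (mu A).
have c0 : 0 < c by rewrite fine_gt0// A0 ltey_eq Afin.
apply: dist_le; split; first exact: ltW.
(* The uniform probability density on the cap. *)
exists (potential ((fun=> c^-1) \_ A)).
  exists ((fun=> c^-1) \_ A); split => //.
    by apply/(measurable_restrictT _ mA).
  exists `|c^-1| => x; rewrite patchE; case: ifP => //; by rewrite normr0.
move=> i Ki; rewrite /mkern mul1r /potential asboolT// mul1r.
have -> : \int[mu]_(x in S) (((fun=> c^-1) \_ A) x * kern x i) =
    \int[mu]_(x in A) (c^-1 * kern x i).
  rewrite -[in RHS](setIidr AS) Rintegral_mkcondr; apply: eq_Rintegral => x _.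
  by rewrite !patchE; case: ifP => //; rewrite mul0r.
have Arho x : A x -> enorm (x - x0) <= rho by move=> [_ /ltW].
have := cap_approx (near_polesP Ki) mA AS x0S Arho rhode (integrable_cst c^-1 mA).
rewrite distrC !Rintegral_cst// -/c mulVf ?gt_eqF// mul1r => h.
apply: (le_trans h); rewrite ger0_norm ?invr_ge0 ?(ltW c0)//.
by rewrite mulVf ?gt_eqF// mulr1.
Qed.

Let outer_le1 i : `|outer_mask Gamma i| <= 1.
Proof. by rewrite /outer_mask; case: asboolP; rewrite ?normr1 ?normr0. Qed.

Section Target.
Variable g : point3 R -> R.
Hypothesis gi : mu.-integrable S (EFin \o g).

Let B A i := outer_mask Gamma i * \int[mu]_(x in A) (g x * kern x i).

Let giA A : measurable A -> A `<=` S -> mu.-integrable A (EFin \o g).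
Proof. by move=> mA AS; exact: (integrableS mS mA AS gi). Qed.

Let ubB A : measurable A -> A `<=` S -> ubounded K (B A).
Proof.
move=> mA AS; exists (kern_bound * \int[mu]_(x in A) `|g x|) => i /near_polesP Ni.
rewrite normrM; apply: (@le_trans _ _ `|\int[mu]_(x in A) (g x * kern x i)|).
  by rewrite ler_piMl.
rewrite (le_trans (le_normr_Rintegral _ (integrable_kern Ni mA AS (giA mA AS))))//.
rewrite -RintegralZl//; last exact/integrable_norm/giA.
apply: le_Rintegral => //.
- exact/integrable_norm/integrable_kern/giA.
- by have := integrableZl mA kern_bound (integrable_norm (giA mA AS)).
by move=> x Ax; rewrite normrM mulrC ler_wpM2r// kern_le//; exact: AS.
Qed.

(** Up to the error in [cap_approx], [B A] is a multiple of one outer kernel, which is at distance 0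
    by the decoupling. *)
Let dist_cap A x0 rho : measurable A -> A `<=` S -> S x0 ->
  (forall x, A x -> enorm (x - x0) <= rho) -> rho <= de / 16 -> 0 <= rho ->
  dist K V (B A) <= L * rho * \int[mu]_(x in A) `|g x|.
Proof.
move=> mA AS x0S Arho rhode rho0.
have ub : ubounded K (mkern (outer_mask Gamma) x0).
  exists kern_bound => i /near_polesP Ni; rewrite normrM.
  by rewrite (le_trans _ (kern_le Ni x0S))// ler_piMl.
have d0 := dist_outer_kern hR1 hR10 hR02 Gamma_closed Gamma_sphere Gamma_neq V0 VD Vsphere x0S.
pose a := \int[mu]_(x in A) g x.
have M0 : 0 <= L * rho * \int[mu]_(x in A) `|g x|.
  by apply: mulr_ge0; [exact: mulr_ge0|exact: Rintegral_ge0].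
apply: (le_trans (dist_perturb V0 VD (e := fun i => a * mkern (outer_mask Gamma) x0 i) _ M0 _)).
- exact: uboundedZ.
- move=> i /near_polesP Ni.
  have -> : B A i - a * mkern (outer_mask Gamma) x0 i = outer_mask Gamma i *
    (\int[mu]_(x in A) (g x * kern x i) - a * kern x0 i).
    by rewrite /B /mkern; ring.
  rewrite normrM (le_trans _ (cap_approx Ni mA AS x0S Arho rhode (giA mA AS)))//.
  by rewrite ler_piMl.
by rewrite -[leRHS]add0r lerD2r (le_trans (distZ V0 VD _ ub))// d0 mulr0.
Qed.

(** The error on a cap is proportional to the mass of [|g|] there, hence additive over disjoint
    pieces: the number of caps does not enter. The induction peels one cap off [A], which must
    therefore be general. *)
Let dist_cover rho (s : seq (point3 R)) A : rho <= de / 16 -> 0 <= rho ->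
  (forall x, x \in s -> S x) -> measurable A -> A `<=` S ->
  (forall x, A x -> exists2 x0, x0 \in s & enorm (x - x0) < rho) ->
  dist K V (B A) <= L * rho * \int[mu]_(x in A) `|g x|.
Proof.
move=> rhode rho0; elim: s A => [|x0 s IH] A sS mA AS As.
  have -> : A = set0 by apply/seteqP; split => // x /As[].
  rewrite Rintegral_set0 mulr0; apply: dist_le_norm => // i _.
  by rewrite /B Rintegral_set0 mulr0 normr0.
have x0S : S x0 by apply: sS; rewrite mem_head.
pose A1 := A `&` cap R2 x0 rho; pose A2 := A `\` cap R2 x0 rho.
have mC := measurable_cap R2 x0 rho.
have mA1 : measurable A1 by exact: measurableI.
have mA2 : measurable A2 by exact: measurableD.
have A1S : A1 `<=` S by move=> x [/AS].
have A2S : A2 `<=` S by move=> x [/AS].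
have AE : A = A1 `|` A2 by rewrite /A1 /A2 setUIDK.
have dis : [disjoint A1 & A2].
  by apply/disj_set2P; rewrite /A1 /A2 setDE setIACA setICr setI0.
have I1 : dist K V (B A1) <= L * rho * \int[mu]_(x in A1) `|g x|.
  by apply: (dist_cap mA1 A1S x0S) => // x [_ [_ /ltW]].
have I2 : dist K V (B A2) <= L * rho * \int[mu]_(x in A2) `|g x|.
  apply: IH => //.
    by move=> x xs; apply: sS; rewrite in_cons xs orbT.
  move=> x [Ax nx]; have [z + xz] := As _ Ax.
  rewrite in_cons => /predU1P[zx0|zs]; last by exists z.
  by exfalso; apply: nx; split; [exact: AS|rewrite -zx0].
have BE i : K i -> B A1 i + B A2 i = B A i.
  move=> /near_polesP Ni; rewrite /B -mulrDr; congr (_ * _).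
  rewrite [in RHS]AE Rintegral_setU//.
  by rewrite -AE; apply: integrable_kern => //; exact: giA.
rewrite -(eq_dist V0 VD (uboundedD (ubB mA1 A1S) (ubB mA2 A2S)) BE).
rewrite (le_trans (distD V0 VD (ubB mA1 A1S) (ubB mA2 A2S)))//.
rewrite (le_trans (lerD I1 I2))// -mulrDr.
rewrite [in leRHS]AE Rintegral_setU// -AE.
exact/integrable_norm/giA.
Qed.

Lemma outer_potential_approx (eps : R) : 0 < eps ->
  exists f : point3 R -> R, [/\ measurable_fun setT f, exists M : R, forall x, `|f x| <= M &
    forall i, K i -> `|outer_mask Gamma i * \int[mu]_(x in S) (g x * kern x i)
      - \int[mu]_(x in S) (f x * kern x i)| <= eps].
Proof.
move=> eps0.
have I0 : 0 <= \int[mu]_(x in S) `|g x| by exact: Rintegral_ge0.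
have LI1 : 0 < L * \int[mu]_(x in S) `|g x| + 1 by rewrite ltr_wpDl// mulr_ge0.
(* The second bound gives a total error of at most [eps / 2], strictly below [eps] as [dist_lt]
   requires. *)
pose rho := Num.min (de / 16) (eps / 2 / (L * \int[mu]_(x in S) `|g x| + 1)).
have rho0 : 0 < rho by rewrite lt_min !divr_gt0.
have rhode : rho <= de / 16 by rewrite ge_min lexx.
have [s [sS sc]] : exists s : seq (point3 R), (forall x, x \in s -> S x) /\
    forall x, S x -> exists2 x0, x0 \in s & enorm (x - x0) < rho.
  have cS : compact S.
    have -> : S = [set x | R2 <= enorm x <= R2].
      by apply/seteqP; split => x /=; [move=> ->; rewrite lexx|rewrite -eq_le => /eqP].
    exact: compact_annulus.
  exact: compact_finite_net.
have := dist_cover rhode (ltW rho0) sS mS (@subset_refl _ _) sc => h.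
have : dist K V (B S) < eps.
  apply: (le_lt_trans h).
  apply: (@le_lt_trans _ _ (eps / 2)); last by rewrite ltr_pdivrMr// ltr_pMr// ltr1n.
  rewrite mulrAC; set I := \int[_]_(x in _) _ in I0 LI1 rho rho0 rhode sc h *.
  apply: (@le_trans _ _ ((L * I + 1) * (eps / 2 / (L * I + 1)))).
    apply: ler_pM; [exact: mulr_ge0|exact: ltW| |by rewrite ge_min lexx orbT].
    by rewrite lerDl.
  by rewrite mulrC divfK// gt_eqF.
move=> hlt.
have [_ [F [f [mf fM ->]] hF]] := dist_lt V0 (ubB mS (@subset_refl _ _)) hlt.
exists f; split=> // i Ki; have := hF i Ki.
by rewrite /B /potential asboolT// mul1r.
Qed.

End Target.
End Approximation.

(** * Pairings with square integrable sources *)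

Section L2Lemmas.
Context {R : realType}.
Implicit Types (r : R) (S : set (point3 R)) (f : point3 R -> R).

Lemma L2_integrable r S f : L2 r S f ->
  (surface r).-integrable setT (EFin \o (f \_ S)).
Proof.
move=> fL2; apply/Lfun1_integrable; apply: Lfun_subset12 fL2.
by rewrite fin_num_measure.
Qed.

Lemma L2_of_sqr r S f : measurable_fun setT (f \_ S) ->
  (surface r).-integrable setT (EFin \o (fun x => (f \_ S) x ^+ 2)) -> L2 r S f.
Proof.
move=> mf /integrableP[_ fy]; rewrite /L2 inE; apply/andP; split; rewrite inE//=.
rewrite /finite_norm unlock poweR_lty//.
apply: le_lt_trans fy; rewrite le_eqVlt; apply/orP; left; apply/eqP.
apply: eq_integral => x _ /=.
by rewrite powR_mulrn// normrX.
Qed.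

Lemma L2_bounded r S f (M : R) : measurable S -> measurable_fun setT f ->
  (forall x, `|f x| <= M) -> L2 r S f.
Proof.
move=> mS mf fM.
have mfS : measurable_fun setT (f \_ S).
  by apply/(measurable_restrictT _ mS); exact: measurable_funTS.
apply: L2_of_sqr => //; apply: (@integrable_bounded _ r _ _ (M ^+ 2)) => //.
  exact: measurable_funX.
move=> x; rewrite normrX lerXn2r ?nnegrE//; first exact: le_trans (fM x).
rewrite patchE; case: ifP => // _; rewrite normr0; exact: le_trans (fM x).
Qed.

(** The L^2 norm of the constant 1, which is the factor in Hoelder's inequality. *)
Definition surface_sqrt r : R := fine ((surface r setT) `^ 2^-1)%E.

Lemma surface_sqrt_ge0 r : 0 <= surface_sqrt r.
Proof. by rewrite fine_ge0// poweR_ge0. Qed.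

Lemma L2norm_ge0 r S f : 0 <= L2norm r S f.
Proof. by rewrite fine_ge0// Lnorm_ge0. Qed.

(* Hoelder's inequality against the constant 1. *)
Lemma L1_le_L2 r S f : L2 r S f ->
  \int[surface r]_x `|(f \_ S) x| <= surface_sqrt r * L2norm r S f.
Proof.
move=> fL2; have := fL2; rewrite /L2 inE => /andP[]; rewrite !inE/= => mf ff.
have h := @hoelder _ _ _ (surface r) (f \_ S) (cst 1) 2 2 mf
  (measurable_cst _) ltac:(by []) ltac:(by []) ltac:(by lra).
rewrite -lee_fin /Rintegral fineK; last first.
  by apply: integrable_fin_num => //; exact/integrable_norm/L2_integrable.
have -> : (\int[surface r]_x `|(f \_ S) x|%:E)%E =
    ('N[surface r]_1[EFin \o (f \_ S \* cst 1)%R])%E.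
  by rewrite Lnorm1; apply: eq_integral => x _ /=; rewrite mulr1.
apply: (le_trans h); rewrite EFinM muleC.
rewrite Lnorm_cst1 /surface_sqrt /L2norm !fineK//.
  by rewrite ge0_fin_numE ?Lnorm_ge0.
by rewrite ge0_fin_numE ?poweR_ge0// poweR_lty// surface_setT_lty.
Qed.

Lemma measurable_patch_enorm (m : point3 R -> point3 R) r S : L2vec r S m ->
  measurable_fun setT ((enorm \o m) \_ S).
Proof.
have mL2 f : L2 r S f -> measurable_fun setT (f \_ S).
  by rewrite /L2 inE => /andP[]; rewrite inE.
move=> [/mL2 m1 /mL2 m2 /mL2 m3].
(* Measurability is known for the patched coordinates; [enorm 0 = 0] makes patching commute with the
   norm. *)
have -> : (enorm \o m) \_ S = fun x => enorm
   (((fun y => (m y).1.1) \_ S) x, ((fun y => (m y).1.2) \_ S) x, ((fun y => (m y).2) \_ S) x).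
  by apply/funext => x; rewrite !patchE; case: ifP => _ //=; rewrite -[LHS]enorm0.
apply: measurable_enorm; apply: measurable_fun_pair => //.
exact: measurable_fun_pair.
Qed.

Lemma L2vec_enorm r S (m : point3 R -> point3 R) : L2vec r S m -> L2 r S (enorm \o m).
Proof.
move=> mL2; apply: L2_of_sqr; first exact: measurable_patch_enorm mL2.
case: mL2 => /Lfun2_integrable_sqr h1 /Lfun2_integrable_sqr h2 /Lfun2_integrable_sqr h3.
have := integrableD measurableT (integrableD measurableT h1 h2) h3.
apply: eq_integrable => // x _ /=.
rewrite -!EFinD; congr EFin; rewrite !patchE; case: ifP => _.
  by rewrite /= sqr_enorm /edot; ring.
by rewrite expr0n /= !addr0.
Qed.

Lemma abs_coord_le (x : point3 R) :
  [/\ `|x.1.1| <= enorm x, `|x.1.2| <= enorm x & `|x.2| <= enorm x].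
Proof.
have := (sqr_ge0 x.1.1, sqr_ge0 x.1.2, sqr_ge0 x.2) => -[[h1 h2] h3].
by split; rewrite -sqrtr_sqr /enorm ler_wsqrtr// /edot -!expr2; lra.
Qed.

Lemma L1_coord_le r S (m : point3 R -> point3 R) (p : point3 R -> R) :
  (forall x, `|p x| <= enorm x) -> L2 r S (p \o m) -> L2vec r S m ->
  \int[surface r]_y `|((p \o m) \_ S) y| <= surface_sqrt r * L2vec_norm r S m.
Proof.
move=> pe pL2 mL2; have eL2 := L2vec_enorm mL2.
apply: le_trans (L1_le_L2 eL2); apply: le_Rintegral => //.
- by apply: integrable_norm; exact: L2_integrable.
- by apply: integrable_norm; exact: L2_integrable.
move=> y _; rewrite !patchE; case: ifP => // _ /=.
by rewrite [leRHS]ger0_norm ?enorm_ge0.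
Qed.

End L2Lemmas.

(** * Layer potentials and their pairings, by Fubini *)

Section Pairing.
Context {R : realType}.
Variables (R0 R1 R2 : R).
Hypotheses (hR1 : 0 < R1) (hR02 : R0 < R2).
Local Notation mu := (@surface R R2).
Local Notation S := (@sphere R R2).
Variables (r al : R) (U : point3 R -> point3 R) (B : set (point3 R)) (h : point3 R -> R).
Hypothesis mU : measurable_fun setT U.
Hypothesis mB : measurable B.
Hypothesis B_near : forall y, B y -> near_poles R0 R1 (al, U y, y).
Hypothesis hi : (surface r).-integrable setT (EFin \o h).
Hypothesis h_supp : forall y, h y != 0 -> B y.

(** The indicators make the kernel bounded on the whole product, where Fubini's theorem is applied;
    they change nothing for [x] in [S], since [h] vanishes off [B]. *)
Definition cut_kern (z : point3 R * point3 R) : R :=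
  \1_S z.1 * \1_B z.2 * pole al (U z.2) (z.1 - z.2).

Let mcut : measurable_fun setT cut_kern.
Proof.
apply: measurable_funM.
  apply: measurable_funM; apply: measurableT_comp => //; apply: measurable_indic => //.
  exact: measurable_sphere.
by apply: measurable_pole; [exact: measurableT_comp|exact: measurable_subp].
Qed.

Let cut_le z : `|cut_kern z| <= kern_bound R0 R1 R2.
Proof.
have M0 := kern_bound_ge0 hR1 hR02.
rewrite /cut_kern !indicE; case: (boolP (_ \in _)) => [/set_mem z1|_]; last by rewrite !mul0r normr0.
case: (boolP (_ \in _)) => [/set_mem z2|_]; last by rewrite mulr0 mul0r normr0.
by rewrite !mul1r; exact: (kern_le hR1 hR02 (B_near z2) z1).
Qed.

Definition layer x : R := \int[surface r]_y (h y * cut_kern (x, y)).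

Definition layer_pairing (w : point3 R -> R) : R := \int[mu]_x ((w \_ S) x * layer x).

Lemma layerE x : S x ->
  layer x = \int[surface r]_y (h y * kern x (al, U y, y)).
Proof.
move=> Sx; apply: eq_Rintegral => y _; rewrite /cut_kern !indicE mem_set// mul1r.
have [->|/h_supp By] := eqVneq (h y) 0; first by rewrite !mul0r.
by rewrite mem_set// mul1r.
Qed.

Lemma integrable_layer_kern x : S x ->
  (surface r).-integrable setT (EFin \o (fun y => h y * kern x (al, U y, y))).
Proof.
move=> Sx.
have : (surface r).-integrable setT (EFin \o (fun y => h y * cut_kern (x, y))).
  apply: (integrable_mul_bounded (M := kern_bound R0 R1 R2)) => //.
  by apply: measurableT_comp => //; exact: measurable_pair1.
apply: eq_integrable => // y _ /=; congr EFin.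
rewrite /cut_kern !indicE mem_set// mul1r.
have [->|/h_supp By] := eqVneq (h y) 0; first by rewrite !mul0r.
by rewrite mem_set// mul1r.
Qed.

Section Weights.
Variable w : point3 R -> R.
Hypothesis wi : mu.-integrable setT (EFin \o (w \_ S)).

Lemma integrable_layer :
  mu.-integrable setT (EFin \o (fun x => (w \_ S) x * layer x)).
Proof. exact: (integrable_bilinear wi hi mcut cut_le). Qed.

(** After the exchange of integrals, the inner one is the potential of [w] at a single pole, the
    quantity that the approximation controls. *)
Lemma layer_pairing_le (e : R) :
  (forall y, h y != 0 -> `|\int[mu]_(x in S) (w x * kern x (al, U y, y))| <= e) ->
  `|layer_pairing w| <= e * \int[surface r]_y `|h y|.
Proof.
move=> he; apply: (Rintegral_bilinear_le wi hi mcut cut_le) => y hy.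
apply: le_trans (he _ hy); rewrite [in leRHS]Rintegral_mkcond le_eqVlt; apply/orP; left.
apply/eqP; congr `|_|; apply: eq_Rintegral => x _.
rewrite !patchE /cut_kern !indicE /= (mem_set (h_supp hy)); case: ifP => _.
  by rewrite !mul1r.
by rewrite !mul0r.
Qed.

End Weights.

Lemma layer_pairingB (f g : point3 R -> R) :
  mu.-integrable setT (EFin \o (f \_ S)) -> mu.-integrable setT (EFin \o (g \_ S)) ->
  layer_pairing f - layer_pairing g = layer_pairing (fun x => f x - g x).
Proof.
move=> fi gi; rewrite /layer_pairing -RintegralB//; [|exact: integrable_layer..].
apply: eq_Rintegral => x _; rewrite -mulrBl !patchE; case: ifP => _ //.
by rewrite subr0.
Qed.

End Pairing.

Lemma measurable_eball {R : realType} (r : R) :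
  measurable [set y : point3 R | enorm y <= r].
Proof.
have m : measurable_fun setT (fun y : point3 R => enorm y).
  by apply: measurable_enorm; exact: measurable_id.
have := m measurableT `]-oo, r]%classic (measurable_itv _).
by rewrite setTI; congr measurable; apply/seteqP; split => y /=; rewrite in_itv.
Qed.

(** * The two operators as layer potentials *)

Section Representation.
Context {R : realType}.
Variables (R0 R1 R2 : R) (Gamma : set (point3 R)).
Hypotheses (hR1 : 0 < R1) (hR10 : R1 < R0) (hR02 : R0 < R2).
Hypothesis (Gamma_sphere : Gamma `<=` sphere R0).
Variables (m : point3 R -> point3 R) (h : point3 R -> R).
Hypotheses (mL2 : L2vec R0 Gamma m) (hL2 : L2 R1 (sphere R1) h).
Local Notation S := (@sphere R R2).

(** A measurable set that contains Gamma and still keeps the distance [R2 - R0] to the outer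
    sphere. *)
Let ball0 := [set y : point3 R | enorm y <= R0].

(** Since [layer] has a scalar density, the field is split into three layers of dipoles of fixed
    direction [e], weighted by the coordinate [p]. *)
Definition dipole_layer (e : point3 R) (p : point3 R -> R) :=
  layer R2 R0 0 (cst e) ball0 ((p \o m) \_ Gamma).

Definition charge_layer :=
  layer R2 R1 1 (fun y => 2 *: y) (sphere R1) (h \_ (sphere R1)).

Lemma dipole_near e y : enorm e = 1 -> ball0 y -> near_poles R0 R1 (0, e, y).
Proof.
by move=> e1 y0; split => //=; rewrite ?normr0// e1 lerDl mulr_ge0// ltW.
Qed.

Lemma dipole_supp (p : point3 R -> R) y : ((p \o m) \_ Gamma) y != 0 -> Gamma y.
Proof. by rewrite patchE; case: ifP => [/set_mem//|_]; rewrite eqxx. Qed.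

Lemma dipole_supp0 (p : point3 R -> R) y : ((p \o m) \_ Gamma) y != 0 -> ball0 y.
Proof. by move=> /dipole_supp/Gamma_sphere yR0; rewrite /ball0/= yR0. Qed.

Lemma charge_near y : sphere R1 y -> near_poles R0 R1 (1, 2 *: y, y).
Proof.
move=> yR1; split => /=; rewrite ?normr1// ?yR1 ?(ltW hR10)//.
by rewrite enormZ yR1 ger0_norm// lerDr.
Qed.

Lemma charge_supp y : (h \_ (sphere R1)) y != 0 -> sphere R1 y.
Proof. by rewrite patchE; case: ifP => [/set_mem//|_]; rewrite eqxx. Qed.

Lemma measurable_double : measurable_fun setT (fun y : point3 R => 2 *: y).
Proof.
have -> : (fun y : point3 R => 2 *: y) = fun y => y - (0 - y).
  by apply/funext => y; rewrite sub0r opprK scaler_nat mulr2n.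
by apply: measurable_subp => //; exact: measurable_subp.
Qed.

Lemma Phi0E x : S x -> Phi0 R0 Gamma m x = (4 * pi)^-1 *
  (dipole_layer (1, 0, 0) (fun v => v.1.1) x +
   dipole_layer (0, 1, 0) (fun v => v.1.2) x +
   dipole_layer (0, 0, 1) (fun v => v.2) x).
Proof.
move=> Sx; case: mL2 => /L2_integrable i1 /L2_integrable i2 /L2_integrable i3.
have ax e : e \in axes -> enorm e = 1 by exact: axes_enorm.
have E (e : point3 R) (p : point3 R -> R) : e \in axes ->
    (surface R0).-integrable setT (EFin \o ((p \o m) \_ Gamma)) ->
    dipole_layer e p x =
      \int[surface R0]_y (((p \o m) \_ Gamma) y * kern x (0, e, y)) /\
    (surface R0).-integrable setT
      (EFin \o (fun y => ((p \o m) \_ Gamma) y * kern x (0, e, y))).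
  move=> /ax e1 ip; split.
    by apply: layerE => //; exact: dipole_supp0.
  apply: (integrable_layer_kern hR1 hR02 _ (measurable_eball R0) _ ip) => //.
  - by move=> y yB; exact: dipole_near.
  - exact: dipole_supp0.
have [|E1 I1] := E (1, 0, 0) (fun v => v.1.1) _ i1; first by rewrite !inE eqxx.
have [|E2 I2] := E (0, 1, 0) (fun v => v.1.2) _ i2; first by rewrite !inE eqxx orbT.
have [|E3 I3] := E (0, 0, 1) (fun v => v.2) _ i3; first by rewrite !inE eqxx !orbT.
rewrite E1 E2 E3 -RintegralD// -RintegralD//; last first.
  by have := integrableD measurableT I1 I2.
rewrite /Phi0; congr (_ * _); rewrite Rintegral_mkcond; apply: eq_Rintegral => y _.
rewrite !patchE; case: ifP => _; last by rewrite !mul0r !addr0.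
by rewrite /kern /pole /edot /=; ring.
Qed.

Lemma Phi1E x : S x -> Phi1 R1 h x = (4 * pi * R1)^-1 * charge_layer x.
Proof.
move=> Sx; rewrite /Phi1 /charge_layer (layerE _ _ _ charge_supp)//.
congr (_ * _); rewrite Rintegral_mkcond; apply: eq_Rintegral => y _.
rewrite !patchE; case: ifP => [/set_mem yR1|_]; last by rewrite mul0r.
rewrite /kern /pole/= -yR1 !sqr_enorm; congr (_ * (_ / _)).
by rewrite /edot /= /GRing.scale /=; ring.
Qed.

End Representation.

(** * From uniform approximation at the poles to inner products *)

Section InnerProducts.
Context {R : realType}.
Variables (R0 R1 R2 : R) (Gamma : set (point3 R)).
Hypotheses (hR1 : 0 < R1) (hR10 : R1 < R0) (hR02 : R0 < R2).
Hypothesis (Gamma_sphere : Gamma `<=` sphere R0).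
Variables (m : point3 R -> point3 R) (h : point3 R -> R).
Hypotheses (mL2 : L2vec R0 Gamma m) (hL2 : L2 R1 (sphere R1) h).
Local Notation S := (@sphere R R2).
Local Notation mu := (@surface R R2).

Definition dipole_pairing (e : point3 R) (p w : point3 R -> R) :=
  layer_pairing R2 R0 0 (cst e) [set y | enorm y <= R0] ((p \o m) \_ Gamma) w.

Definition charge_pairing (w : point3 R -> R) :=
  layer_pairing R2 R1 1 (fun y => 2 *: y) (sphere R1) (h \_ (sphere R1)) w.

Definition dipole_pairings w :=
  dipole_pairing (1, 0, 0) (fun v => v.1.1) w +
  dipole_pairing (0, 1, 0) (fun v => v.1.2) w +
  dipole_pairing (0, 0, 1) (fun v => v.2) w.

Let integrable_dipole e (p w : point3 R -> R) : e \in axes ->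
  L2 R0 Gamma (p \o m) -> mu.-integrable setT (EFin \o (w \_ S)) ->
  mu.-integrable setT (EFin \o (fun x => (w \_ S) x * dipole_layer R0 R2 Gamma m e p x)).
Proof.
move=> eA pL2 wi.
apply: (integrable_layer (R0 := R0) (R1 := R1)) => //.
- exact: measurable_eball.
- by move=> y; apply: (dipole_near hR1); exact: axes_enorm.
- exact: L2_integrable.
Qed.

Let integrable_charge (w : point3 R -> R) : mu.-integrable setT (EFin \o (w \_ S)) ->
  mu.-integrable setT (EFin \o (fun x => (w \_ S) x * charge_layer R1 R2 h x)).
Proof.
move=> wi; apply: (integrable_layer (R0 := R0) (R1 := R1)) => //.
- exact: measurable_double.
- exact: measurable_sphere.
- exact: charge_near.
- exact: L2_integrable.
Qed.

Lemma L2inner_Phi0 w : mu.-integrable setT (EFin \o (w \_ S)) ->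
  L2inner R2 S (Phi0 R0 Gamma m) w = (4 * pi)^-1 * dipole_pairings w.
Proof.
move=> wi; case: (mL2) => L1 L2 L3.
have I1 := @integrable_dipole (1, 0, 0) (fun v => v.1.1) w ltac:(by rewrite !inE eqxx) L1 wi.
have I2 := @integrable_dipole (0, 1, 0) (fun v => v.1.2) w ltac:(by rewrite !inE eqxx orbT) L2 wi.
have I3 := @integrable_dipole (0, 0, 1) (fun v => v.2) w ltac:(by rewrite !inE eqxx !orbT) L3 wi.
have I12 := integrableD measurableT I1 I2.
rewrite /dipole_pairings /dipole_pairing /layer_pairing -RintegralD// -RintegralD//.
rewrite -RintegralZl//; last by have := integrableD measurableT I12 I3.
rewrite /L2inner Rintegral_mkcond; apply: eq_Rintegral => x _.
rewrite !patchE; case: ifP => [/set_mem Sx|_]; last by rewrite !mul0r !addr0 mulr0.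
by rewrite (Phi0E hR1 hR02 Gamma_sphere mL2 Sx) /dipole_layer; ring.
Qed.

Lemma L2inner_Phi w : mu.-integrable setT (EFin \o (w \_ S)) ->
  L2inner R2 S (Phi R1 R0 Gamma m h) w =
  (4 * pi)^-1 * dipole_pairings w + (4 * pi * R1)^-1 * charge_pairing w.
Proof.
move=> wi; rewrite -L2inner_Phi0// /charge_pairing /layer_pairing.
have I4 := integrable_charge wi.
have I0 : mu.-integrable setT (EFin \o ((fun x => Phi0 R0 Gamma m x * w x) \_ S)).
  case: (mL2) => L1 L2 L3.
  have I1 := @integrable_dipole (1, 0, 0) (fun v => v.1.1) w ltac:(by rewrite !inE eqxx) L1 wi.
  have I2 := @integrable_dipole (0, 1, 0) (fun v => v.1.2) w ltac:(by rewrite !inE eqxx orbT) L2 wi.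
  have I3 := @integrable_dipole (0, 0, 1) (fun v => v.2) w ltac:(by rewrite !inE eqxx !orbT) L3 wi.
  have := integrableZl measurableT (4 * pi)^-1
    (integrableD measurableT (integrableD measurableT I1 I2) I3).
  apply: eq_integrable => // x _ /=.
  rewrite -!EFinD -EFinM !patchE; congr EFin; case: ifP => [/set_mem Sx|_].
    by rewrite (Phi0E hR1 hR02 Gamma_sphere mL2 Sx); ring.
  by rewrite !mul0r !addr0 mulr0.
have -> : L2inner R2 S (Phi0 R0 Gamma m) w =
    \int[mu]_x ((fun x => Phi0 R0 Gamma m x * w x) \_ S) x.
  by rewrite /L2inner Rintegral_mkcond.
rewrite -RintegralZl// -RintegralD//.
  rewrite /L2inner Rintegral_mkcond; apply: eq_Rintegral => x _; rewrite !patchE; case: ifP => [/set_mem Sx|_].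
    by rewrite /Phi (Phi1E R1 h Sx) /charge_layer; ring.
  by rewrite mul0r mulr0 addr0.
by have := integrableZl measurableT (4 * pi * R1)^-1 I4.
Qed.

Variables (f g : point3 R -> R).
Hypotheses (fi : mu.-integrable setT (EFin \o (f \_ S)))
           (gi : mu.-integrable setT (EFin \o (g \_ S))).
Variable eps : R.
Hypothesis approx_fg : forall i, (outer_poles Gamma `|` inner_poles R1) i ->
  `|outer_mask Gamma i * \int[mu]_(x in S) (g x * kern x i)
      - \int[mu]_(x in S) (f x * kern x i)| <= eps.

Let mS : measurable S. Proof. exact: measurable_sphere. Qed.

Let on_sphere w : mu.-integrable setT (EFin \o (w \_ S)) ->
  mu.-integrable S (EFin \o w).
Proof.
by move=> wi; apply/integrable_mkcond => //; apply: eq_integrable wi => // x _;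
  rewrite restrict_EFin.
Qed.

(** The poles [(0, e, y)] with [y] in Gamma are outer, so the mask is 1 and the hypothesis compares
    the potentials of [f] and [g] there. *)
Lemma dipole_pairing_le e (p : point3 R -> R) : e \in axes ->
  L2 R0 Gamma (p \o m) -> (forall v, `|p v| <= enorm v) -> 0 <= eps ->
  `|dipole_pairing e p f - dipole_pairing e p g| <=
  eps * (surface_sqrt R0 * L2vec_norm R0 Gamma m).
Proof.
move=> eA pL2 pe eps0; have e1 := axes_enorm eA.
have near y : enorm y <= R0 -> near_poles R0 R1 (0, e, y) by exact: dipole_near.
have hi := L2_integrable pL2.
have mB := measurable_eball R0.
have supp := dipole_supp0 Gamma_sphere (m := m) (p := p).
rewrite (layer_pairingB hR1 hR02 _ mB near hi)//.
have fgi : mu.-integrable setT (EFin \o ((fun x => f x - g x) \_ S)).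
  have := integrableB measurableT fi gi; apply: eq_integrable => // x _ /=.
  by rewrite -EFinB !patchE; case: ifP => //; rewrite subr0.
apply: (le_trans (layer_pairing_le hR1 hR02 _ mB near hi supp fgi (e := eps) _)) => //.
  move=> y /dipole_supp yG.
  have Ki : outer_poles Gamma (0, e, y) by split => //=; rewrite e1.
  have Ni : near_poles R0 R1 (0, e, y) by apply: near; rewrite (Gamma_sphere yG).
  have := approx_fg (or_introl Ki); rewrite /outer_mask asboolT// mul1r distrC.
  have SS : S `<=` S by [].
  rewrite -RintegralB//; [|by apply: (integrable_kern hR1 hR02 Ni mS SS); exact: on_sphere..].
  by under eq_Rintegral do rewrite -mulrBl.
by rewrite ler_wpM2l//; exact: (L1_coord_le pe pL2 mL2).
Qed.

(** Inner poles have charge 1, so the outer mask vanishes there and the hypothesis bounds the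
    potential of [f] itself. *)
Lemma charge_pairing_le : 0 <= eps ->
  `|charge_pairing f| <= eps * (surface_sqrt R1 * L2norm R1 (sphere R1) h).
Proof.
move=> eps0.
have hi := L2_integrable hL2.
have supp := charge_supp (R1 := R1) (h := h).
have near y : sphere R1 y -> near_poles R0 R1 (1, 2 *: y, y) by exact: charge_near.
apply: (le_trans (layer_pairing_le hR1 hR02 measurable_double (measurable_sphere R1) near hi supp fi (e := eps) _)).
  move=> y /supp yR1.
  have Ki : inner_poles R1 (1, 2 *: y, y) by split.
  have := approx_fg (or_intror Ki); rewrite /outer_mask asboolF.
    by rewrite mul0r sub0r normrN.
  by case => /= /eqP; rewrite oner_eq0.
by rewrite ler_wpM2l// L1_le_L2.
Qed.

(** Each of the three coordinates of [m] is estimated by the whole norm, whence the factor 3. *)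
Lemma L2inner_diff_le : 0 <= eps ->
  `| L2inner R2 S (Phi R1 R0 Gamma m h) f - L2inner R2 S (Phi0 R0 Gamma m) g | <=
  eps * ((4 * pi)^-1 * (3 * surface_sqrt R0) + (4 * pi * R1)^-1 * surface_sqrt R1)
   * prod_norm R0 Gamma R1 (sphere R1) m h.
Proof.
move=> eps0; rewrite L2inner_Phi// L2inner_Phi0//.
have abs3 (a1 a2 a3 b1 b2 b3 X : R) : `|a1 - b1| <= X -> `|a2 - b2| <= X ->
    `|a3 - b3| <= X -> `|a1 + a2 + a3 - (b1 + b2 + b3)| <= 3 * X.
  rewrite !ler_norml => /andP[? ?] /andP[? ?] /andP[? ?].
  by apply/andP; split; lra.
set N := prod_norm _ _ _ _ _ _.
have [L1 L2 L3] := mL2.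
pose Nm := L2vec_norm R0 Gamma m; pose Nh := L2norm R1 (sphere R1) h.
have Nm0 : 0 <= Nm by exact: L2norm_ge0.
have Nh0 : 0 <= Nh by exact: L2norm_ge0.
have NmN : Nm <= N.
  by rewrite /N /prod_norm -[leLHS]ger0_norm// -sqrtr_sqr ler_wsqrtr// lerDl sqr_ge0.
have NhN : Nh <= N.
  by rewrite /N /prod_norm -[leLHS]ger0_norm// -sqrtr_sqr ler_wsqrtr// lerDr sqr_ge0.
have c0 : 0 <= (4 * pi)^-1 :> R by rewrite invr_ge0 mulr_ge0// pi_ge0.
have c1 : 0 <= (4 * pi * R1)^-1 :> R.
  by rewrite invr_ge0 !mulr_ge0 ?pi_ge0// ltW.
have coord := @abs_coord_le R.
have D1 := @dipole_pairing_le (1, 0, 0) (fun v => v.1.1) ltac:(by rewrite !inE eqxx) L1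
  ltac:(by move=> v; case: (coord v)) eps0.
have D2 := @dipole_pairing_le (0, 1, 0) (fun v => v.1.2) ltac:(by rewrite !inE eqxx orbT) L2
  ltac:(by move=> v; case: (coord v)) eps0.
have D3 := @dipole_pairing_le (0, 0, 1) (fun v => v.2) ltac:(by rewrite !inE eqxx !orbT) L3
  ltac:(by move=> v; case: (coord v)) eps0.
have D4 := charge_pairing_le eps0.
have s0 := surface_sqrt_ge0 R0; have s1 := surface_sqrt_ge0 R1.
have le0 : eps * (surface_sqrt R0 * Nm) <= eps * (surface_sqrt R0 * N).
  by rewrite ler_wpM2l// ler_wpM2l.
have le1 : eps * (surface_sqrt R1 * Nh) <= eps * (surface_sqrt R1 * N).
  by rewrite ler_wpM2l// ler_wpM2l.
have -> : (4 * pi)^-1 * dipole_pairings f + (4 * pi * R1)^-1 * charge_pairing f -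
    (4 * pi)^-1 * dipole_pairings g =
  (4 * pi)^-1 * (dipole_pairings f - dipole_pairings g) +
  (4 * pi * R1)^-1 * charge_pairing f by ring.
have -> : eps * ((4 * pi)^-1 * (3 * surface_sqrt R0) +
    (4 * pi * R1)^-1 * surface_sqrt R1) * N =
  (4 * pi)^-1 * (3 * (eps * (surface_sqrt R0 * N))) +
  (4 * pi * R1)^-1 * (eps * (surface_sqrt R1 * N)) by ring.
rewrite (le_trans (ler_normD _ _))// lerD//; rewrite normrM ger0_norm// ler_wpM2l//.
  apply: (le_trans (abs3 _ _ _ _ _ _ _ D1 D2 D3)).
  by rewrite ler_wpM2l.
exact: le_trans D4 le1.
Qed.

End InnerProducts.

Theorem corollary4p13 (R : realType) (R0 R1 R2 : R) (Gamma : set (point3 R))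
    (hR1 : 0 < R1) (hR10 : R1 < R0) (hR02 : R0 < R2)
    (Gamma_closed : closed Gamma) (Gamma_sphere : Gamma `<=` sphere R0)
    (Gamma_neq : Gamma <> sphere R0)
    (eps : R) (heps : 0 < eps)
    (g : point3 R -> R) (hg : L2 R2 (sphere R2) g) :
  exists2 f : point3 R -> R, L2 R2 (sphere R2) f &
    forall (m : point3 R -> point3 R) (h : point3 R -> R),
      L2vec R0 Gamma m -> L2 R1 (sphere R1) h ->
      `| L2inner R2 (sphere R2) (Phi R1 R0 Gamma m h) f
         - L2inner R2 (sphere R2) (Phi0 R0 Gamma m) g |
      <= eps * prod_norm R0 Gamma R1 (sphere R1) m h.
Proof.
(* The constant of [L2inner_diff_le], independent of [m] and [h]; dividing [eps] by [C + 1] avoids a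
   zero divisor. *)
pose C : R := (4 * pi)^-1 * (3 * surface_sqrt R0) + (4 * pi * R1)^-1 * surface_sqrt R1.
have C0 : 0 <= C.
  have p0 := @pi_ge0 R; have s0 := surface_sqrt_ge0 R0; have s1 := surface_sqrt_ge0 R1.
  by apply: addr_ge0; apply: mulr_ge0; rewrite ?invr_ge0 ?mulr_ge0// ltW.
have C1 : 0 < C + 1 by rewrite ltr_wpDl.
have mS : measurable (sphere R2) by exact: measurable_sphere.
have gi := L2_integrable hg.
have gi' : (surface R2).-integrable (sphere R2) (EFin \o g).
  by apply/integrable_mkcond => //; apply: eq_integrable gi => // x _;
    rewrite restrict_EFin.
have eC : 0 < eps / (C + 1) by rewrite divr_gt0.
have [f [mf [M fM] fg]] := outer_potential_approx hR1 hR10 hR02 Gamma_closed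
  Gamma_sphere Gamma_neq gi' eC.
have fL2 : L2 R2 (sphere R2) f by exact: (L2_bounded _ mS mf fM).
exists f => // m h mL2 hL2.
apply: (le_trans (L2inner_diff_le hR1 hR10 hR02 Gamma_sphere mL2 hL2
  (L2_integrable fL2) gi fg (ltW eC))).
rewrite ler_wpM2r ?sqrtr_ge0// -/C mulrAC ler_pdivrMr// ler_wpM2l ?(ltW heps)//.
by rewrite lerDl.
Qed.
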